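(* Let $k\ge1$ be an integer, $\lambda,\mu>0$, $\theta>0$, $\alpha\in(0,1)$. The inter-arrival times $T^{\theta,\alpha}$ of the tempered Erlang queue $Q^{\theta,\alpha}$ are independent and identically distributed with \begin{equation*} \Pr(T^{\theta,\alpha}>t)=e^{-\theta t}\sum_{q=0}^{\infty}(\theta t)^q\sum_{r=0}^{\infty}(-\lambda t^\alpha)^rE_{\alpha, r\alpha+q+1}^r(\theta^\alpha t^\alpha),\qquad t\ge0. \end{equation*}
   Context: Erlang queue: $\{Q(t)\}_{t\ge0}$, $Q(t)=(N(t),S(t))$, with $N(t)$ the number of customers and $S(t)$ the phase of the customer in service, where customers arrive according to a Poisson process of rate $\lambda$ and service is Erlang with $k$ phases each exponential of rate $k\mu$. Let $D_{\theta,\alpha}$ be the subordinator with $\mathbb{E}e^{-sD_{\theta,\alpha}(t)}=e^{-t((s+\theta)^\alpha-\theta^\alpha)}$ and $Y_{\theta,\alpha}(t)=\inf\{x>0:D_{\theta,\alpha}(x)>t\}$, independent of $Q$; the tempered Erlang queue is $Q^{\theta,\alpha}(t)=Q(Y_{\theta,\alpha}(t))$. If $\tau_1<\tau_2<\cdots$ are the arrival epochs of the underlying queue, the $n$-th arrival of $Q^{\theta,\alpha}$ occurs at time $T_n=\inf\{t\ge0: Y_{\theta,\alpha}(t)\ge\tau_n\}$, and the inter-arrival times are $T_n-T_{n-1}$ ($T_0=0$). Three-parameter Mittag-Leffler function: $E_{\alpha,b}^{\gamma}(x)=\sum_{j\ge0}\frac{(\gamma)_j x^j}{j!\Gamma(\alpha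 j+b)}$ with Pochhammer symbol $(\gamma)_j=\gamma(\gamma+1)\cdots(\gamma+j-1)$, $(\gamma)_0=1$ (so $E^0_{\alpha,b}(x)=1/\Gamma(b)$). *)

(* Defs.v *)
From HB Require Import structures.
From mathcomp Require Import all_boot all_order all_algebra.
From mathcomp Require Import all_classical all_reals all_analysis.
Set Implicit Arguments. Unset Strict Implicit. Unset Printing Implicit Defensive.
Import Order.TTheory GRing.Theory Num.Theory.
Import numFieldNormedType.Exports.
Local Open Scope classical_set_scope.
Local Open Scope ring_scope.

Definition Gamma (R : realType) (x : R) : R :=
  Rintegral (@lebesgue_measure R) `]0%R, +oo[
            (fun u => powR u (x - 1) * expR (- u)).

Definition pochhammer (R : realType) (g : R) (j : nat) : R :=
  \prod_(i < j) (g + i%:R).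

Definition ML3 (R : realType) (a b g x : R) : R :=
  limn (series (fun j : nat =>
    pochhammer g j * x ^+ j / ((j`!)%:R * Gamma (a * j%:R + b)))).

Definition mutually_independent (d : measure_display) (T : measurableType d)
  (R : realType) (P : probability T R) (I : eqType) (X : I -> T -> R) : Prop :=
  forall (J : seq I) (B : I -> set R), uniq J ->
    (forall i, measurable (B i)) ->
    P (\big[setI/setT]_(i <- J) (X i @^-1` B i)) =
      (\prod_(i <- J) fine (P (X i @^-1` B i)))%:E.

(* Arrival epochs of the underlying (Poisson) arrival stream from the
   inter-arrival times E_0, E_1, ... : tau_n = E_0 + ... + E_{n-1}. *)
Definition arrival_epoch (T : Type) (R : realType) (E : nat -> T -> R)
  (n : nat) (w : T) : R := \sum_(i < n) E i w.

Definition inverse_sub (T : Type) (R : realType) (D : R -> T -> R)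
  (t : R) (w : T) : R := inf [set x : R | 0 < x /\ t < D x w].

Definition tc_arrival (T : Type) (R : realType) (D : R -> T -> R)
  (E : nat -> T -> R) (n : nat) (w : T) : R :=
  inf [set t : R | 0 <= t /\ arrival_epoch E n w <= inverse_sub D t w].

(* n-th inter-arrival time (n >= 1) indexed from 0: T_{n+1} - T_n. *)
Definition tc_interarrival (T : Type) (R : realType) (D : R -> T -> R)
  (E : nat -> T -> R) (n : nat) (w : T) : R :=
  tc_arrival D E n.+1 w - tc_arrival D E n w.

(* Main.v *)
Require Import Defs.
From HB Require Import structures.
From mathcomp Require Import all_boot all_order all_algebra.
From mathcomp Require Import all_classical all_reals all_analysis.
From mathcomp Require Import measurable_realfun ring lra.
Import Order.TTheory GRing.Theory Num.Theory.
Import numFieldNormedType.Exports.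
Local Open Scope classical_set_scope.
Local Open Scope ring_scope.

(* On a set of full measure the n-th arrival occurs at T_n = D(tau_n -), the left
   limit of the subordinator at tau_n.  Rounding the E_i down to a grid turns
   D(tau_(i+1) -) - D(tau_i -) into increments of D over a finite random
   partition, so conditioning on the finitely many grid values and letting the
   mesh go to 0 gives, with psi(s) = (s + theta)^alpha - theta^alpha,
     E exp(- sum_i s_i W_i) = prod_i lambda / (lambda + psi(s_i)).
   Laplace transforms determine laws (Bernstein polynomials approximate
   indicators of rays), hence the W_i are i.i.d. and the Laplace transform of
   t |-> P(W > t) is psi(s) / (s (psi(s) + lambda)).  Integrating the double
   Mittag-Leffler series term by term against exp(- z t), for z = s + theta
   large, gives geometric and negative binomial series with the same sum; since
   both functions are right-continuous they coincide. *)

Set Implicit Arguments. Unset Strict Implicit. Unset Printing Implicit Defensive.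

(** * Polynomial approximation and uniqueness of Laplace transforms *)

(** The obstacle is [D] at random times: measurability of [D] is given at each fixed time only, and
    independence only for increments over deterministic partitions. A grid with finitely many values
    reduces everything to finite sums over deterministic partitions. Each [E i] is rounded
    separately, so that the length of the i-th random interval depends on [E i] alone and the joint
    transform splits into a product; the rounding is strictly downwards because the arrival epochs
    are left limits of [D]. On the analytic side, the triple series of absolute values is summable
    against [exp(- z t)] only when [theta^alpha + lambda < z^alpha], so the two transforms can be
    compared only far to the right. This suffices because the uniqueness lemma asks for natural
    arguments only: a factor [exp(- s0 t)] moves the region of comparison to start at 0. The lemma
    also carries a weight. With the weight a function on the half-line it separates functions; with
    the weight a product of factors of the other coordinates it turns joint transforms into joint
    laws. *)

Section bernstein.
Variable R : realType.
Implicit Types (h g : nat -> R) (u c : R).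

(* [(bernstein h N k).[u]] is the expectation of [h (k + Bin(N, u))]. *)
Fixpoint bernstein h (N k : nat) : {poly R} :=
  if N is N'.+1 then
    'X * bernstein h N' k.+1 + (1 - 'X) * bernstein h N' k
  else (h k)%:P.

Lemma horner_bernsteinS h N k u : (bernstein h N.+1 k).[u] =
  u * (bernstein h N k.+1).[u] + (1 - u) * (bernstein h N k).[u].
Proof. by rewrite /= !hornerE. Qed.

Lemma ler_bernstein h g N k u : 0 <= u <= 1 -> (forall j, h j <= g j) ->
  (bernstein h N k).[u] <= (bernstein g N k).[u].
Proof.
move=> /andP[u0 u1] hg; elim: N k => [|N IH] k; first by rewrite /= !hornerE.
by rewrite !horner_bernsteinS lerD// ler_wpM2l// subr_ge0.
Qed.

Lemma bernsteinZ h c N k u :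
  (bernstein (fun j => c * h j) N k).[u] = c * (bernstein h N k).[u].
Proof.
elim: N k => [|N IH] k; first by rewrite /= !hornerE.
by rewrite !horner_bernsteinS !IH; ring.
Qed.

Lemma bernstein_onem h N k u :
  (bernstein (fun j => 1 - h j) N k).[u] = 1 - (bernstein h N k).[u].
Proof.
elim: N k => [|N IH] k; first by rewrite /= !hornerE.
by rewrite !horner_bernsteinS !IH; ring.
Qed.

Lemma bernstein_cst c N k u : (bernstein (fun=> c) N k).[u] = c.
Proof.
elim: N k => [|N IH] k; first by rewrite /= !hornerE.
by rewrite !horner_bernsteinS !IH; ring.
Qed.

(** Bias squared plus variance, for the mean [k + N u] and the variance [N u (1 - u)]. *)
Lemma bernstein_sqr c N k u :
  (bernstein (fun j => (j%:R - c) ^+ 2) N k).[u] =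
  (k%:R + N%:R * u - c) ^+ 2 + N%:R * u * (1 - u).
Proof.
elim: N k => [|N IH] k; first by rewrite /= !hornerE.
by rewrite !horner_bernsteinS !IH -!natr1; ring.
Qed.

(** Chebyshev's inequality; in use [h] indicates a deviation of at least [b] from the mean, and the
    variance is at most [N]. *)
Lemma bernstein_chebyshev h N u b : 0 <= u <= 1 -> 0 < b ->
  (forall j, h j <= ((j%:R - N%:R * u) / b) ^+ 2) ->
  (bernstein h N 0).[u] <= N%:R / b ^+ 2.
Proof.
move=> u01 b0 hb; apply: le_trans (ler_bernstein N 0 u01 hb) _.
under [fun j => _]funext do rewrite exprMn mulrC exprVn.
rewrite bernsteinZ bernstein_sqr add0r subrr expr0n add0r mulrC.
rewrite -[_ * _ * (1 - u)]mulrA ler_wpM2r ?invr_ge0 ?exprn_ge0 ?(ltW b0)// ler_piMr ?ler0n//.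
by case/andP: u01 => u0 u1; nra.
Qed.

(** Bernstein polynomials of degree [m ^ 4] for a step whose threshold lies [1 / m] to the right of
    [c]. In counts the shift is [m ^ 3], beyond the standard deviation of order [m ^ 2]; hence the
    limit is 0 at [u = c] as well, and laws with atoms are covered. *)
Lemma step_polys c : exists p : nat -> {poly R},
  (forall n u, 0 <= u <= 1 -> 0 <= (p n).[u] <= 1) /\
  (forall u, 0 <= u <= 1 -> (fun n => (p n).[u]) @ \oo --> ((c < u)%R%:R : R)).
Proof.
pose m n : R := n.+1%:R.
have m1 n : 1 <= m n by rewrite ler1n.
have m0 n : 0 < m n by rewrite ltr0n.
pose h n (k : nat) : R := (c * m n ^+ 4 + m n ^+ 3 < k%:R)%R%:R.
pose p n := bernstein (h n) (n.+1 ^ 4) 0.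
have p01 n u : 0 <= u <= 1 -> 0 <= (p n).[u] <= 1.
  move=> u01; rewrite -(bernstein_cst 0 (n.+1 ^ 4) 0 u).
  rewrite -[X in _ <= _ <= X](bernstein_cst 1 (n.+1 ^ 4) 0 u).
  by rewrite !ler_bernstein// => j; rewrite /h; case: (_ < _).
have bnd n : (n.+1 ^ 4)%:R / (m n ^+ 3) ^+ 2 <= (m n)^-1.
  rewrite natrX -/(m n) -exprM ler_pdivrMr ?exprn_gt0//.
  rewrite (_ : (3 * 2 = 6)%N)// [m n ^+ 6]exprS mulKf ?gt_eqF//.
  by rewrite ler_eXn2l_n || rewrite ler_weXn2l.
exists p; split => // u u01.
have [uc|cu] := leP u c.
  rewrite /=; apply: (@squeeze_cvgr _ _ _ _ (fun=> 0) (fun n => (m n)^-1)).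
  - near=> n; case/andP: (p01 n u u01) => -> _ /=.
    apply: le_trans (bnd n).
    apply: bernstein_chebyshev => //; first by rewrite exprn_gt0.
    move=> j; rewrite /h; case: ltP => [cj|_]; last by rewrite sqr_ge0.
    rewrite /= expr_ge1 ?divr_ge0 ?exprn_ge0 ?(ltW (m0 _))//.
      rewrite ler_pdivlMr ?exprn_gt0// mul1r natrX -/(m n).
      have : u * m n ^+ 4 <= c * m n ^+ 4 by rewrite ler_wpM2r ?exprn_ge0 ?(ltW (m0 n)).
      lra.
    rewrite subr_ge0 natrX -/(m n).
    have : u * m n ^+ 4 <= c * m n ^+ 4 by rewrite ler_wpM2r ?exprn_ge0 ?(ltW (m0 n)).
    have : 0 < m n ^+ 3 by rewrite exprn_gt0.
    lra.
  - exact: cvg_cst.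
  - exact: cvg_harmonic.
rewrite /=; apply: (@squeeze_cvgr _ _ _ _ (fun n => 1 - (m n)^-1) (fun=> 1)).
- near=> n; case/andP: (p01 n u u01) => _ -> /=; rewrite andbT.
  rewrite lerBlDr -lerBlDl; apply: le_trans (bnd n).
  rewrite -bernstein_onem; apply: bernstein_chebyshev => //.
    by rewrite exprn_gt0.
  move=> j; rewrite /h; case: ltP => [_|jc]; first by rewrite subrr sqr_ge0.
  (* With a gap [u - c] of at least [2 / m], the threshold [c m^4 + m^3] is still at least [m^3]
     below the mean [m^4 u]. *)
  have mu : 2 <= (u - c) * m n.
    rewrite -ler_pdivrMl ?subr_gt0// /m -[n.+1%:R]natr1 -lerBlDr.
    by near: n; exact: nbhs_infty_ger.
  have : m n ^+ 3 * 2 <= m n ^+ 3 * ((u - c) * m n).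
    by rewrite ler_wpM2l// exprn_ge0// ltW.
  rewrite subr0 -sqrrN -mulNr natrX -/(m n) => mu3.
  have e4 : m n ^+ 4 = m n ^+ 3 * m n by rewrite -exprSr.
  have m3 : 0 < m n ^+ 3 by rewrite exprn_gt0.
  have le3 : m n ^+ 3 <= - (j%:R - m n ^+ 4 * u) by rewrite e4 in jc *; lra.
  rewrite expr_ge1//; first by rewrite ler_pdivlMr// mul1r.
  by rewrite divr_ge0 ?(ltW m3)// (le_trans _ le3)// ltW.
- rewrite -[X in _ --> X]subr0; apply: cvgB; first exact: cvg_cst.
  exact: cvg_harmonic.
- exact: cvg_cst.
Unshelve. all: end_near. Qed.

End bernstein.

(** * Uniqueness of weighted Laplace transforms from their values at natural numbers *)

Section laplace_uniqueness.
Variable R : realType.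

Lemma Rintegral_sum d (T : measurableType d) (mu : {measure set T -> \bar R})
    (D : set T) (I : Type) (s : seq I) (f : I -> T -> R) :
  measurable D -> (forall i, mu.-integrable D (EFin \o f i)) ->
  \int[mu]_(x in D) (\sum_(i <- s) f i x) =
  \sum_(i <- s) \int[mu]_(x in D) f i x.
Proof.
move=> mD intf; elim: s => [|i s IH].
  by under eq_Rintegral do rewrite big_nil; rewrite big_nil Rintegral_cst// mul0r.
under eq_Rintegral do rewrite big_cons.
rewrite big_cons RintegralD//; first by rewrite IH.
have := integrable_sum mD s (P := xpredT) (fun i _ => intf i).
by apply: eq_integrable => // x _; rewrite /= -sumEFin.
Qed.

Lemma integrable_bounded_mul d (T : measurableType d)
    (mu : {measure set T -> \bar R}) (D : set T) (Z g : T -> R) (M : R) :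
  measurable D -> mu.-integrable D (EFin \o Z) -> measurable_fun D g ->
  (forall x, D x -> `|g x| <= M) ->
  mu.-integrable D (EFin \o (fun x => Z x * g x)).
Proof.
move=> mD iZ mg gM; have M0 x : D x -> 0 <= M by move/gM; apply: le_trans.
apply: (@le_integrable _ _ _ mu D mD _ (EFin \o (fun x => M * Z x))).
- apply/measurable_EFinP; apply: measurable_funM => //.
  by apply/measurable_EFinP; exact: measurable_int iZ.
- move=> x Dx /=; rewrite lee_fin !normrM mulrC ler_wpM2r//.
  by rewrite (le_trans (gM x Dx)) ?ler_norm.
- by have := integrableZl mD M iZ; apply: eq_integrable.
Qed.

Lemma Rintegral_cvg d (T : measurableType d) (mu : {measure set T -> \bar R})
    (D : set T) (f_ : nat -> T -> R) (f g : T -> R) :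
  measurable D -> (forall n, measurable_fun D (f_ n)) -> measurable_fun D f ->
  (forall x, D x -> f_ ^~ x @ \oo --> f x) ->
  mu.-integrable D (EFin \o g) ->
  (forall n x, D x -> `|f_ n x| <= g x) ->
  mu.-integrable D (EFin \o f) /\
  (fun n => \int[mu]_(x in D) f_ n x) @ \oo --> \int[mu]_(x in D) f x.
Proof.
move=> mD mf_ mf ff ig fg.
have [|||||intf _ cv] := @dominated_convergence _ _ _ mu D mD
  (fun n => EFin \o f_ n) (EFin \o f) (EFin \o g).
- by move=> n; exact/measurable_EFinP.
- exact/measurable_EFinP.
- by apply: aeW => x Dx; apply: cvg_EFin; [exact: nearW|exact: ff].
- exact: ig.
- by apply: aeW => x n Dx /=; rewrite lee_fin fg.
split=> //; rewrite /Rintegral; apply: fine_cvg.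
by rewrite fineK//; exact: integrable_fin_num.
Qed.

(** A polynomial in [exp(- X)] is a finite combination of the [exp(- i X)], so its integral sees the
    Laplace transform at natural numbers only. *)
Lemma Rintegral_horner d (T : measurableType d)
    (mu : {measure set T -> \bar R}) (D : set T) (Z X : T -> R) (p : {poly R}) :
  measurable D -> mu.-integrable D (EFin \o Z) -> measurable_fun D X ->
  (forall x, D x -> 0 <= X x) ->
  \int[mu]_(x in D) (Z x * p.[expR (- X x)]) =
  \sum_(i < size p) p`_i * \int[mu]_(x in D) (Z x * expR (- (i%:R * X x))).
Proof.
move=> mD iZ mX X0.
have mexp (i : nat) : measurable_fun D (fun x => expR (- (i%:R * X x))).
  by apply: measurableT_comp => //; apply: measurable_funN;
     exact: measurable_funM.
have iexp (i : nat) :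
    mu.-integrable D (EFin \o (fun x => Z x * expR (- (i%:R * X x)))).
  apply: (@integrable_bounded_mul _ _ _ _ _ _ 1) => // x Dx.
  by rewrite ger0_norm ?expR_ge0// -expR0 ler_expR oppr_le0 mulr_ge0// X0.
transitivity (\int[mu]_(x in D)
    (\sum_(i < size p) p`_i * (Z x * expR (- (i%:R * X x))))).
  apply: eq_Rintegral => x _; rewrite horner_coef mulr_sumr.
  apply: eq_bigr => i _; rewrite -expRM_natl mulrN; ring.
rewrite Rintegral_sum//; last first.
  by move=> i; have := integrableZl mD (p`_i) (iexp i); apply: eq_integrable.
by apply: eq_bigr => i _; rewrite RintegralZl.
Qed.

(** Since [exp(- t) < exp(- X)] means [X < t], a step in [exp(- X)] is a ray in [X]; [|Z|] dominates
    because the polynomials stay in [[0, 1]]. *)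
Lemma Rintegral_step_cvg d (T : measurableType d)
    (mu : {measure set T -> \bar R}) (D : set T) (Z X : T -> R) (t : R)
    (p : nat -> {poly R}) :
  (forall n u, 0 <= u <= 1 -> 0 <= (p n).[u] <= 1) ->
  (forall u, 0 <= u <= 1 ->
    (fun n => (p n).[u]) @ \oo --> ((expR (- t) < u)%R%:R : R)) ->
  measurable D -> mu.-integrable D (EFin \o Z) -> measurable_fun D X ->
  (forall x, D x -> 0 <= X x) ->
  (fun n => \int[mu]_(x in D) (Z x * (p n).[expR (- X x)])) @ \oo -->
  \int[mu]_(x in D) (Z x * \1_[set y | y < t] (X x)).
Proof.
move=> p01 pcvg mD iZ mX X0.
have u01 x : D x -> 0 <= expR (- X x) <= 1.
  by move=> Dx; rewrite expR_ge0 -expR0 ler_expR oppr_le0 X0.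
have mZ : measurable_fun D Z by apply/measurable_EFinP; exact: measurable_int iZ.
apply: (proj2 (@Rintegral_cvg _ _ mu D _ _ (fun x => `|Z x|) _ _ _ _ _ _)) => //.
- move=> n; apply: measurable_funM => //.
  have mh : measurable_fun setT (fun u => (p n).[u]).
    by apply: continuous_measurable_fun; exact: continuous_horner.
  apply: measurableT_comp => //; apply: measurableT_comp => //.
  exact: measurable_funN.
- apply: measurable_funM => //; apply: measurableT_comp => //.
  apply: measurable_indic; rewrite (_ : [set y | _] = `]-oo, t[%classic)//.
- move=> x Dx; apply: cvgMr => //; have := pcvg _ (u01 x Dx).
  by rewrite ltr_expR ltrN2 indicE mem_setE.
- by have := integrable_norm iZ; apply: eq_integrable.
- move=> n x Dx; rewrite normrM ler_piMr//.
  by have /andP[p0 p1] := p01 n _ (u01 x Dx); rewrite ger0_norm.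
Qed.

(** The weights [Z], [Z'] may have any sign and depend on anything. The lemma serves with [Z] a
    function and [X] the identity for Lebesgue measure, and with [Z] a product of factors of other
    coordinates for [P]. *)
Lemma laplace_unique d d' (T : measurableType d) (T' : measurableType d')
    (mu : {measure set T -> \bar R}) (mu' : {measure set T' -> \bar R})
    (D : set T) (D' : set T') (Z X : T -> R) (Z' X' : T' -> R) :
  measurable D -> mu.-integrable D (EFin \o Z) -> measurable_fun D X ->
  (forall x, D x -> 0 <= X x) ->
  measurable D' -> mu'.-integrable D' (EFin \o Z') -> measurable_fun D' X' ->
  (forall x, D' x -> 0 <= X' x) ->
  (forall n : nat, \int[mu]_(x in D) (Z x * expR (- (n%:R * X x))) =
     \int[mu']_(x in D') (Z' x * expR (- (n%:R * X' x)))) ->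
  forall t, \int[mu]_(x in D) (Z x * \1_[set y | y < t] (X x)) =
            \int[mu']_(x in D') (Z' x * \1_[set y | y < t] (X' x)).
Proof.
move=> mD iZ mX X0 mD' iZ' mX' X0' eqL t.
have [p [p01 pcvg]] := step_polys (expR (- t)).
have := Rintegral_step_cvg p01 pcvg mD iZ mX X0.
have := Rintegral_step_cvg p01 pcvg mD' iZ' mX' X0'.
under eq_fun do rewrite Rintegral_horner//.
under [in X in _ -> X -> _]eq_fun do rewrite Rintegral_horner//.
under [in X in _ -> X -> _]eq_fun do under eq_bigr do rewrite eqL.
by move=> c1 c2; exact: (cvg_unique _ c2 c1).
Qed.

End laplace_uniqueness.

(** * Laplace transform of the Mittag-Leffler series *)

Section laplace_transforms.
Variable R : realType.
Notation mu := (@lebesgue_measure R).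
Notation Rpos := (`]0, +oo[%classic : set R).

Lemma integrableZlr d (T : measurableType d) (nu : {measure set T -> \bar R})
    (D : set T) (c : R) (f : T -> R) : measurable D ->
  nu.-integrable D (EFin \o f) -> nu.-integrable D (EFin \o (fun t => c * f t)).
Proof. by move=> mD /(integrableZl mD c); apply: eq_integrable. Qed.

Lemma integrable_expRN (z : R) : 0 < z ->
  mu.-integrable Rpos (EFin \o (fun t => expR (- (z * t)))) /\
  \int[mu]_(t in Rpos) expR (- (z * t)) = z^-1.
Proof.
move=> z0.
have iE : mu.-integrable `[0, +oo[%classic
    (EFin \o (fun t => z * expR (- z * t))).
  have := integrable_exponential_pdf z0; rewrite /exponential_pdf.
  rewrite -restrict_EFin => h; apply/(integrable_mkcond _ _).2 => //.
have iE' : mu.-integrable Rpos (EFin \o (fun t => z * expR (- z * t))).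
  by apply: integrableS iE => //; apply: subset_itvr; rewrite bnd_simp.
have I1 : \int[mu]_(t in Rpos) (z * expR (- z * t)) = 1.
  rewrite Rintegral_itv_obnd_cbnd// Rintegral_mkcond /Rintegral.
  by rewrite -[1]/(fine 1%E) -(integral_exponential_pdf z0).
have iz : mu.-integrable Rpos (EFin \o (fun t => expR (- (z * t)))).
  have := integrableZlr z^-1 _ iE'; move=> /(_ (measurable_itv _)).
  apply: eq_integrable => // t _ /=.
  by rewrite mulrA mulVf ?gt_eqF// mul1r mulNr.
split=> //; apply: (mulfI (lt0r_neq0 z0)); rewrite divff ?gt_eqF//.
by rewrite -RintegralZl// -[RHS]I1; apply: eq_Rintegral => t _; rewrite mulNr.
Qed.

Lemma powR_cvg_right (b t : R) : 0 <= b -> 0 <= t ->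
  powR x b @[x --> t^'+] --> powR t b.
Proof.
rewrite le_eqVlt => /predU1P[<- _|b0].
  by rewrite powRr0; under eq_fun do rewrite powRr0; exact: cvg_cst.
rewrite le_eqVlt => /predU1P[<-|t0].
  by rewrite powR0 ?gt_eqF//; exact: powR_cvg0.
apply: cvg_at_right_filter.
have : derivable (@powR R ^~ b) t 1 by apply: derivable_powR; rewrite in_itv/= t0.
by move/derivable1_diffP/differentiable_continuous.
Qed.

Lemma powRDn (x r s : R) : 0 <= r -> 0 <= s ->
  powR x (r + s) = powR x r * powR x s.
Proof.
move=> r0 s0; have [rs0|rs0] := eqVneq (r + s) 0.
  have [-> ->] : r = 0 /\ s = 0 by split; lra.
  by rewrite addr0 !powRr0 mulr1.
have [->|x0] := eqVneq x 0; last by apply: powRD; rewrite x0 implybT.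
rewrite powR0//; have [r_0|r_0] := eqVneq r 0.
  by rewrite r_0 powRr0 mul1r powR0//; apply: contra_neq rs0 => ->; rewrite r_0 addr0.
by rewrite (powR0 r_0) mul0r.
Qed.

Lemma powR_le_expR (b : R) : 0 <= b -> exists2 C : R, 0 <= C &
  forall t, 0 <= t -> powR t b <= C * expR (t / 2).
Proof.
(* From [t / c <= exp(t / c)] follows [t^b <= c^b exp(b t / c)], and this [c] makes [b / c <= 1 / 2]
   while staying positive at [b = 0]. *)
move=> b0; pose c : R := 2 * (b + 1); have c0 : 0 < c by rewrite /c; lra.
exists (powR c b) => [|t t0]; first exact: powR_ge0.
rewrite -{1}(divfK (lt0r_neq0 c0) t) mulrC powRM ?divr_ge0 ?(ltW c0)//.
rewrite ler_wpM2l ?powR_ge0//.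
apply: (@le_trans _ _ (powR (expR (t / c)) b)).
  apply: ge0_ler_powR => //; rewrite ?nnegrE ?expR_ge0 ?divr_ge0 ?(ltW c0)//.
  by apply: le_trans (expR_ge1Dx _); rewrite lerDr.
rewrite -expRM ler_expR mulrAC ler_pdivrMr// mulrC.
have : 0 <= b * t by rewrite mulr_ge0.
by rewrite /c; lra.
Qed.

Lemma integrable_Gamma (b : R) : 0 <= b ->
  mu.-integrable Rpos (EFin \o (fun t => powR t b * expR (- t))).
Proof.
move=> b0; have [C C0 hC] := powR_le_expR b0.
have h2 : (0 : R) < 2^-1 by lra.
have [ie _] := integrable_expRN h2.
apply: le_integrable (integrableZlr C _ ie) => //.
- apply/measurable_EFinP; apply: measurable_funM.
    by apply: measurable_funTS; exact: measurable_powR.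
  by apply: measurableT_comp => //; exact: measurable_funN.
- move=> t /=; rewrite in_itv/= andbT => t0.
  rewrite lee_fin !normrM (ger0_norm (expR_ge0 _)) (ger0_norm (powR_ge0 _ _)).
  rewrite (ger0_norm C0) (ger0_norm (expR_ge0 _)).
  apply: (@le_trans _ _ (C * expR (t / 2) * expR (- t))).
    by rewrite ler_wpM2r ?expR_ge0 ?hC ?ltW.
  by rewrite -mulrA -expRD ler_wpM2l// ler_expR; lra.
Qed.

(** Only the part of the integral over []v, v + 1[] is kept, where the integrand is at least the
    left-hand side. The free [v] is later taken to be [z0 t]. *)
Lemma Gamma_ge (b v : R) : 0 <= b -> 0 <= v ->
  powR v b * expR (- (v + 1)) <= Gamma (b + 1).
Proof.
move=> b0 v0; have iG := integrable_Gamma b0.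
rewrite /Gamma addrK -/mu.
pose J := `]v, (v + 1)[%classic : set R.
have mJ : measurable J by exact: measurable_itv.
have JR : J `<=` Rpos.
  by move=> t; rewrite /J /= !in_itv/= andbT => /andP[+ _]; exact: le_lt_trans.
have muJ : fine (mu J) = 1.
  by rewrite /J lebesgue_measure_itv/= lte_fin ltrDl ltr01 EFinN -EFinB /= addrC addKr.
rewrite -[leLHS]mulr1 -[X in _ * X]muJ -Rintegral_cst//.
have iJ : mu.-integrable J (EFin \o (fun t => powR t b * expR (- t))).
  by apply: integrableS iG.
apply: (@le_trans _ _ (\int[mu]_(t in J) (powR t b * expR (- t)))).
  apply: le_Rintegral => //.
    apply: measurable_bounded_integrable => //.
    - rewrite [ltLHS](_ : _ = (mu J)%E)// /J lebesgue_measure_itv/=.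
      by rewrite lte_fin ltrDl ltr01 -EFinB ltry.
    - exact: bounded_cst.
  move=> t; rewrite /J /= in_itv/= => /andP[vt tv].
  apply: ler_pM; rewrite ?powR_ge0 ?expR_ge0//.
    by apply: ge0_ler_powR => //; rewrite ?nnegrE ?(ltW vt)// (le_trans v0)// ltW.
  by rewrite ler_expR lerN2 ltW.
rewrite /Rintegral fine_le ?integrable_fin_num//.
apply: ge0_subset_integral => //.
  by apply/measurable_EFinP; case/integrableP: iG => /measurable_EFinP.
by move=> t _; rewrite lee_fin mulr_ge0 ?powR_ge0 ?expR_ge0.
Qed.

Lemma Gamma_gt0 (b : R) : 0 <= b -> 0 < Gamma (b + 1).
Proof.
move=> b0; apply: lt_le_trans (Gamma_ge b0 ler01).
by rewrite powR1 mul1r expR_gt0.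
Qed.

Lemma laplace_powR (b z : R) : 0 <= b -> 0 < z ->
  mu.-integrable Rpos (EFin \o (fun t => expR (- (z * t)) * powR t b)) /\
  \int[mu]_(t in Rpos) (expR (- (z * t)) * powR t b) =
    Gamma (b + 1) * powR z (- (b + 1)).
Proof.
move=> b0 z0.
pose G t : R := powR t b * expR (- t).
have mG : measurable_fun setT G.
  apply: measurable_funM; first exact: measurable_powR.
  by apply: measurableT_comp => //; exact: measurable_funN.
have mGz : measurable_fun setT (fun t => G (z * t) * z).
  apply: measurable_funM => //; apply: measurableT_comp => //.
have G0 t : 0 <= G t by rewrite mulr_ge0 ?powR_ge0 ?expR_ge0.
(* The substitution [u = z t] is made on extended-real integrals of a nonnegative function, so that
   integrability is transferred together with the value. *)
have sub : (\int[mu]_(t in Rpos) (G t)%:E = \int[mu]_(t in Rpos) (G (z * t) * z)%:E)%E.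
  have dz : (fun t : R => z * t)^`()%classic = fun=> z.
    by apply/funext => t; rewrite derive1E deriveZ//= derive_id /GRing.scale/= mulr1.
  rewrite !integral_itv_obnd_cbnd; last 2 first.
    exact/measurable_EFinP/measurable_funTS.
    exact/measurable_EFinP/measurable_funTS.
  rewrite -{1}(mulr0 z).
  rewrite (@increasing_ge0_integration_by_substitutiony _ (fun t : R => z * t) G 0).
  - by apply: eq_integral => t _; rewrite /= !fctE dz.
  - by move=> x y _ _ xy; rewrite ltr_pM2l.
  - by rewrite dz => x _; exact: cvg_cst.
  - by rewrite dz; exact: is_cvg_cst.
  - by rewrite dz; exact: is_cvg_cst.
  - split; first by move=> x _; exact: derivableZ.
    apply: cvg_at_right_filter; apply: cvgM; [exact: cvg_cst|exact: cvg_id].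
  - by apply: gt0_cvgMry => //; exact: cvg_id.
  - apply/continuous_within_itvcyP; split.
    + move=> x; rewrite mulr0 in_itv/= andbT => x0; apply: cvgM.
        have : derivable (@powR R ^~ b) x 1.
          by apply: derivable_powR; rewrite in_itv/= x0.
        by move/derivable1_diffP/differentiable_continuous.
      apply: continuous_comp; [exact: continuousN|exact: continuous_expR].
    + rewrite mulr0; apply: cvgM; first exact: powR_cvg_right.
      apply: cvg_at_right_filter.
      apply: continuous_comp; [exact: continuousN|exact: continuous_expR].
  - by move=> x _; exact: G0.
have iG := integrable_Gamma b0.
have GE t : Rpos t -> G (z * t) * z =
    powR z (b + 1) * (expR (- (z * t)) * powR t b).
  rewrite /= in_itv/= andbT => t0; rewrite /G powRM ?ltW//.
  by rewrite powRDn// powRr1 ?ltW//; ring.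
have iGz : mu.-integrable Rpos (EFin \o (fun t => G (z * t) * z)).
  apply/integrableP; split; first exact/measurable_EFinP/measurable_funTS.
  apply: (@le_lt_trans _ _ (\int[mu]_(t in Rpos) (G (z * t) * z)%:E)%E).
    rewrite le_eqVlt; apply/orP; left; apply/eqP; apply: eq_integral => t _.
    by rewrite /= ger0_norm// mulr_ge0// ltW.
  rewrite -sub; have /integrableP[_] := iG; apply: le_lt_trans.
  rewrite le_eqVlt; apply/orP; left; apply/eqP; apply: eq_integral => t _.
  by rewrite /= ger0_norm ?G0.
have pz : powR z (b + 1) != 0 by rewrite gt_eqF// powR_gt0.
have i1 : mu.-integrable Rpos (EFin \o (fun t => expR (- (z * t)) * powR t b)).
  have := integrableZlr (powR z (b + 1))^-1 _ iGz.
  move=> /(_ (measurable_itv _)); apply: eq_integrable => // t /[!inE] Dt /=.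
  by rewrite GE// mulKf.
split=> //; apply: (mulfI pz).
rewrite -RintegralZl// mulrCA -powRD ?subrr ?powRr0 ?mulr1 ?(gt_eqF z0) ?implybT//.
rewrite /Gamma addrK /Rintegral sub.
by congr fine; apply: eq_integral => t /[!inE] Dt; rewrite GE.
Qed.

End laplace_transforms.

(** * Functions of exponential growth with a known Laplace transform, and their series *)

Section laplace_class.
Variable R : realType.
Notation mu := (@lebesgue_measure R).
Notation Rpos := (`]0, +oo[%classic : set R).

(* Chosen so that the class is closed under series with summable [K]
   ([laplace_at_series]): no growth estimate on Gamma beyond [Gamma_ge] is
   needed. *)
Definition laplace_at (z0 K : R) (f F : R -> R) : Prop :=
  [/\ measurable_fun Rpos f,
      forall t, 0 <= t -> `|f t| <= K * expR (z0 * t),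
      forall t, 0 <= t -> f x @[x --> t^'+] --> f t &
      forall z, z0 < z -> \int[mu]_(t in Rpos) (expR (- (z * t)) * f t) = F z].

Lemma measurable_expRN (z : R) (D : set R) :
  measurable_fun D (fun t => expR (- (z * t))).
Proof.
apply: measurable_funTS; apply: measurableT_comp => //.
by apply: measurable_funN; exact: mulrl_measurable.
Qed.

Lemma laplace_integrable (z0 K z : R) (f : R -> R) : z0 < z ->
  measurable_fun Rpos f ->
  (forall t, 0 <= t -> `|f t| <= K * expR (z0 * t)) ->
  mu.-integrable Rpos (EFin \o (fun t => expR (- (z * t)) * f t)).
Proof.
move=> z0z mf fK; have zz : 0 < z - z0 by rewrite subr_gt0.
have [ie _] := integrable_expRN zz.
have mD : measurable (Rpos : set (measurableTypeR R)) by exact: measurable_itv.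
apply: le_integrable (integrableZlr K mD ie) => //.
- apply/measurable_EFinP; apply: measurable_funM => //.
  exact: measurable_expRN.
- move=> t /=; rewrite in_itv/= andbT => t0.
  rewrite lee_fin normrM (ger0_norm (expR_ge0 _)).
  apply: (@le_trans _ _ (expR (- (z * t)) * (K * expR (z0 * t)))).
    by rewrite ler_wpM2l ?expR_ge0// fK// ltW.
  rewrite mulrCA -expRD [- (z * t) + _](_ : _ = - ((z - z0) * t)); last by ring.
  exact: ler_norm.
Qed.

Lemma laplace_atZ (z0 K c : R) (f F : R -> R) : laplace_at z0 K f F ->
  laplace_at z0 (`|c| * K) (fun t => c * f t) (fun z => c * F z).
Proof.
move=> [mf fK fr fF]; split.
- by apply: measurable_funM.
- by move=> t t0; rewrite normrM -mulrA ler_wpM2l// fK.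
- by move=> t t0; apply: cvgM; [exact: cvg_cst|exact: fr].
- move=> z zz; rewrite -fF// -RintegralZl//; last exact: laplace_integrable fK.
  by apply: eq_Rintegral => t _; rewrite mulrCA.
Qed.

(** The growth bound is [Gamma_ge] at [v = z0 t]. Its constant is the transform at [z0] times
    [e z0], so the constants of a series sum under the same condition as its transforms taken in
    absolute value at [z0]. *)
Lemma laplace_at_powR (z0 b : R) : 0 < z0 -> 0 <= b ->
  laplace_at z0 (expR 1 * powR z0 (- b))
    (fun t => powR t b / Gamma (b + 1)) (fun z => powR z (- (b + 1))).
Proof.
move=> z00 b0; have G0 := Gamma_gt0 b0; split.
- by apply: measurable_funM => //; apply: measurable_funTS; exact: measurable_powR.
- move=> t t0; rewrite ger0_norm ?divr_ge0 ?powR_ge0 ?(ltW G0)//.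
  rewrite ler_pdivrMr//.
  have zt0 : 0 <= z0 * t by rewrite mulr_ge0 ?(ltW z00).
  have := Gamma_ge b0 zt0.
  rewrite powRM ?(ltW z00)// => H.
  have E0 : 0 < expR 1 * powR z0 (- b) * expR (z0 * t).
    by rewrite !mulr_gt0 ?expR_gt0 ?powR_gt0.
  apply: le_trans (ler_wpM2l (ltW E0) H).
  rewrite opprD expRD powRN [leRHS](_ : _ = powR t b *
    (powR z0 b * (powR z0 b)^-1) *
    (expR 1 * expR (- 1)) * (expR (z0 * t) * expR (- (z0 * t)))); last by ring.
  by rewrite -!expRD !subrr expR0 divff ?mulr1// gt_eqF// powR_gt0.
- by move=> t t0; apply: cvgM; [exact: powR_cvg_right|exact: cvg_cst].
- move=> z zz; have z1 := lt_trans z00 zz.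
  have [ip Ip] := laplace_powR b0 z1.
  under eq_Rintegral do rewrite mulrA.
  by rewrite RintegralZr// Ip mulrAC divff ?mul1r ?gt_eqF.
Qed.

(** Tails of the series are at most the tails of [K_] times [exp(z0 t)]: uniform smallness on
    bounded intervals gives right-continuity, and domination by [K exp(z0 t)] gives the transform.
    Convergence is a conclusion, so the identification of [f] with the [limn] may presuppose it. *)
Lemma laplace_at_series (z0 K : R) (f F : R -> R) (K_ : nat -> R)
    (f_ F_ : nat -> R -> R) : 0 <= z0 ->
  (forall n, laplace_at z0 (K_ n) (f_ n) (F_ n)) ->
  series K_ @ \oo --> K ->
  (forall z, z0 < z -> series (F_ ^~ z) @ \oo --> F z) ->
  (forall t, 0 <= t -> cvgn (series (f_ ^~ t)) ->
    f t = limn (series (f_ ^~ t))) ->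
  (forall t, 0 <= t -> cvgn (series (f_ ^~ t))) /\ laplace_at z0 K f F.
Proof.
move=> z00 lf cK cF fE.
have fK n t : 0 <= t -> `|f_ n t| <= K_ n * expR (z0 * t) by case: (lf n) => _ + _ _; apply.
have K0 n : 0 <= K_ n.
  by have := fK n 0 (lexx _); rewrite mulr0 expR0 mulr1; exact: le_trans.
have cK' : cvgn (series K_) by apply/cvg_ex; exists K.
have cvg_f t : 0 <= t -> cvgn (series (f_ ^~ t)).
  move=> t0; apply: normed_cvg.
  apply: (@series_le_cvg _ _ (fun n => expR (z0 * t) * K_ n)) => //.
  - by move=> n; exact: normr_ge0.
  - by move=> n; rewrite mulr_ge0 ?expR_ge0.
  - by move=> n; rewrite mulrC fK.
  - exact: is_cvg_seriesZ.
have cvgf t : 0 <= t -> series (f_ ^~ t) @ \oo --> f t.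
  by move=> t0; rewrite fE//; exact: cvg_f.
have Kle n : series K_ n <= K.
  rewrite -(cvg_lim _ cK)//; apply: nondecreasing_cvgn_le => //.
  by apply: nondecreasing_series => k _ _; exact: K0.
have tail t N : 0 <= t ->
    `|f t - series (f_ ^~ t) N| <= (K - series K_ N) * expR (z0 * t).
  move=> t0.
  have c1 : (fun M => `|series (f_ ^~ t) M - series (f_ ^~ t) N|) @ \oo -->
      `|f t - series (f_ ^~ t) N|.
    by apply: cvg_norm; apply: cvgB; [exact: cvgf|exact: cvg_cst].
  apply: (cvgr_to_le c1); near=> M.
  have NM : (N <= M)%N by near: M; exact: nbhs_infty_ge.
  rewrite sub_series_geq//; apply: (le_trans (ler_norm_sum _ _ _)).
  apply: (@le_trans _ _ (\sum_(N <= k < M) K_ k * expR (z0 * t))).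
    by apply: ler_sum => k _; exact: fK.
  by rewrite -mulr_suml -sub_series_geq// ler_wpM2r ?expR_ge0// lerB.
have mS n : measurable_fun Rpos (fun t => series (f_ ^~ t) n).
  by apply: measurable_sum => k; case: (lf k).
have mf : measurable_fun Rpos f.
  apply: (measurable_fun_cvg mS) => t; rewrite /= in_itv/= andbT => t0.
  by apply: cvgf; exact: ltW.
have fb t : 0 <= t -> `|f t| <= K * expR (z0 * t).
  by move=> t0; have := tail t 0%N t0; rewrite /series/= !big_geq// !subr0.
split=> //; split=> //.
- move=> t t0; apply/cvgrPdist_le => e e0.
  (* The growth factor is frozen at [t + 1], an upper bound for it at every [x] in [[t, t + 1]]. *)
  have e30 : 0 < e / 3 / expR (z0 * (t + 1)).
    by rewrite !divr_gt0// expR_gt0.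
  have [N _ /(_ N (leqnn N)) hN] := (cvgrPdist_le _ _).1 cK _ e30.
  have tailN x : 0 <= x <= t + 1 -> `|f x - series (f_ ^~ x) N| <= e / 3.
    move=> /andP[x0 xt]; apply: (le_trans (tail x N x0)).
    apply: (@le_trans _ _ ((K - series K_ N) * expR (z0 * (t + 1)))).
      by rewrite ler_wpM2l ?subr_ge0// ler_expR ler_wpM2l.
    rewrite -ler_pdivlMr ?expR_gt0//; apply: le_trans hN; exact: ler_norm.
  have Sr : series (f_ ^~ x) N @[x --> t^'+] --> series (f_ ^~ t) N.
    rewrite /series/=; elim: N {hN tailN} => [|N IH].
      by under eq_fun do rewrite big_geq//; rewrite big_geq//; exact: cvg_cst.
    under eq_fun do rewrite big_nat_recr//=; rewrite big_nat_recr//=.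
    by apply: cvgD => //; case: (lf N) => _ _ + _; apply.
  have e3 : 0 < e / 3 by rewrite divr_gt0.
  have hS := (cvgrPdist_le _ _).1 Sr _ e3.
  near=> x.
  have tx : t < x by near: x; exact: nbhs_right_gt.
  have xt : x <= t + 1 by near: x; apply: nbhs_right_le; rewrite ltrDl.
  have h1 : `|f t - series (f_ ^~ t) N| <= e / 3 by apply: tailN; rewrite t0 lerDl/=.
  have h2 : `|f x - series (f_ ^~ x) N| <= e / 3.
    by apply: tailN; rewrite xt (le_trans t0)// ltW.
  have h3 : `|series (f_ ^~ t) N - series (f_ ^~ x) N| <= e / 3 by near: x; exact: hS.
  rewrite (_ : f t - f x = (f t - series (f_ ^~ t) N) +
    (series (f_ ^~ t) N - series (f_ ^~ x) N) - (f x - series (f_ ^~ x) N)); last by ring.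
  apply: (le_trans (ler_normB _ _)); rewrite -lerBrDr.
  apply: (le_trans (ler_normD _ _)); lra.
- move=> z zz.
  have zz0 : 0 < z - z0 by rewrite subr_gt0.
  have mD : measurable (Rpos : set (measurableTypeR R)) by exact: measurable_itv.
  have ig := integrableZlr K mD (integrable_expRN zz0).1.
  have Sb n t : 0 <= t -> `|series (f_ ^~ t) n| <= K * expR (z0 * t).
    move=> t0; apply: (le_trans (ler_norm_sum _ _ _)).
    apply: (@le_trans _ _ (\sum_(0 <= k < n) K_ k * expR (z0 * t))).
      by apply: ler_sum => k _; exact: fK.
    by rewrite -mulr_suml ler_wpM2r ?expR_ge0//; exact: Kle.
  have [] := @Rintegral_cvg R _ _ mu Rpos
    (fun n t => expR (- (z * t)) * series (f_ ^~ t) n)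
    (fun t => expR (- (z * t)) * f t) _ mD _ _ _ ig.
  + by move=> n; apply: measurable_funM; [exact: measurable_expRN|exact: mS].
  + by apply: measurable_funM; [exact: measurable_expRN|exact: mf].
  + move=> t; rewrite /= in_itv/= andbT => t0; apply: cvgM; first exact: cvg_cst.
    by apply: cvgf; exact: ltW.
  + move=> n t; rewrite /= in_itv/= andbT => t0.
    rewrite normrM (ger0_norm (expR_ge0 _)).
    apply: (le_trans (ler_wpM2l (expR_ge0 _) (Sb n t (ltW t0)))).
    by rewrite mulrCA -expRD [- (z * t) + _](_ : _ = - ((z - z0) * t)); last by ring.
  move=> _ c1; apply: (cvg_unique _ c1); first exact: Rhausdorff.
  have := cF z zz; apply: cvg_trans; apply: near_eq_cvg; near=> n.
  rewrite /series/=; under [in RHS]eq_Rintegral do rewrite mulr_sumr.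
  rewrite Rintegral_sum//; last first.
    by move=> k; apply: (laplace_integrable zz) (fK k); case: (lf k).
  by apply: eq_bigr => k _; case: (lf k) => _ _ _ ->.
Unshelve. all: end_near. Qed.

End laplace_class.

(** * The negative binomial series *)

Section negative_binomial.
Variable R : realType.

Lemma pochhammerS (g : R) j : pochhammer g j.+1 = g * pochhammer (g + 1) j.
Proof.
rewrite /pochhammer big_ord_recl addr0; congr (_ * _).
by apply: eq_bigr => i _; rewrite lift0 -addrA -natr1 [1 + _]addrC.
Qed.

(** The binomial coefficient of [r + j - 1] over [j], that is, the coefficient of [x^j] in
    [(1 - x)^(-r)]; for [r = 0] only [j = 0] survives. *)
Definition negbin (r j : nat) : R := pochhammer r%:R j / (j`!)%:R.

Lemma negbin0 r : negbin r 0 = 1.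
Proof. by rewrite /negbin /pochhammer big_ord0 fact0 divr1. Qed.

Lemma negbin0S j : negbin 0 j.+1 = 0.
Proof. by rewrite /negbin pochhammerS !mul0r. Qed.

Lemma negbin_ge0 r j : 0 <= negbin r j.
Proof. by rewrite divr_ge0// prodr_ge0// => i _; rewrite addr_ge0. Qed.

Lemma negbinSS r j : negbin r.+1 j.+1 = negbin r.+1 j + negbin r j.+1.
Proof.
have fS : ((j.+1)`!)%:R = (1 + j%:R) * (j`!)%:R :> R.
  by rewrite factS natrM -natr1 addrC.
have f0 : (j`!)%:R != 0 :> R by rewrite pnatr_eq0 -lt0n fact_gt0.
have j0 : 1 + j%:R != 0 :> R by rewrite -[1]/(1%:R) -natrD pnatr_eq0.
have pS : pochhammer r.+1%:R j.+1 =
    pochhammer r.+1%:R j * (r%:R + 1 + j%:R) :> R.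
  by rewrite natr1 /pochhammer big_ord_recr.
rewrite /negbin pS (pochhammerS r%:R) natr1 fS.
by move: (pochhammer _ _) => p; field; rewrite f0.
Qed.

Lemma cvg_negbin_series r (x : R) : 0 <= x < 1 ->
  series (fun j => negbin r j * x ^+ j) @ \oo --> (1 - x)^-1 ^+ r.
Proof.
move=> /andP[x0 x1]; have x1' : 0 < 1 - x by rewrite subr_gt0.
elim: r => [|r IH].
  rewrite expr0 -(cvg_shiftS (series _)).
  apply: cvg_near_cst; near=> n; rewrite /series/= big_nat_recl//=.
  by rewrite negbin0 mul1r expr0 big1 ?addr0// => k _; rewrite negbin0S mul0r.
set u := fun j => negbin r.+1 j * x ^+ j.
(* Pascal's rule [negbinSS] telescopes up to one boundary term. Its sign bounds the partial sums, so
   the series converges, and then the boundary term vanishes in the limit. *)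
have tel n : (1 - x) * series u n.+1 =
    series (fun j => negbin r j * x ^+ j) n.+1 - u n * x.
  rewrite /series/= /u; elim: n => [|n IHn].
    by rewrite !big_nat1 !negbin0 expr0; ring.
  rewrite big_nat_recr//= [in RHS]big_nat_recr//= mulrDr IHn negbinSS !exprS.
  ring.
have u0 n : 0 <= u n by rewrite mulr_ge0 ?negbin_ge0 ?exprn_ge0.
have cu : cvgn (series u).
  apply: nondecreasing_is_cvgn; first by apply: nondecreasing_series => k _ _.
  exists ((1 - x)^-1 * (1 - x)^-1 ^+ r) => _ [n _ <-].
  apply: (@le_trans _ _ (series u n.+1)); first by rewrite seriesSr lerDl.
  rewrite ler_pdivlMl// tel.
  apply: (@le_trans _ _ (series (fun j => negbin r j * x ^+ j) n.+1)).
    by rewrite lerBlDr lerDl mulr_ge0.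
  rewrite -(cvg_lim _ IH)//; apply: nondecreasing_cvgn_le.
    by apply: nondecreasing_series => k _ _; rewrite mulr_ge0 ?negbin_ge0 ?exprn_ge0.
  by apply/cvg_ex; eexists; exact: IH.
rewrite -(cvg_shiftS (series u)) exprS.
have -> : [sequence series u n.+1]_n = (fun n => (1 - x)^-1 *
    (series (fun j => negbin r j * x ^+ j) n.+1 - u n * x)).
  by apply/funext => n /=; rewrite -tel mulKf ?gt_eqF.
apply: cvgM; first exact: cvg_cst.
rewrite -[X in _ --> X]subr0 -(mul0r x); apply: cvgB.
  by rewrite (cvg_shiftS (series (fun j => negbin r j * x ^+ j))).
by apply: cvgM; [exact: cvg_series_cvg_0|exact: cvg_cst].
Unshelve. all: end_near. Qed.

End negative_binomial.

(** * The triple series, summed over [j], then [r], then [q] *)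

Section mittag_leffler.
Variable R : realType.
Notation mu := (@lebesgue_measure R).
Notation Rpos := (`]0, +oo[%classic : set R).

Lemma cvg_seriesZ (c l : R) (u : nat -> R) : series u @ \oo --> l ->
  series (fun n => c * u n) @ \oo --> c * l.
Proof.
move=> cu; have -> : series (fun n => c * u n) = (fun n => c * series u n).
  by apply/funext => n; rewrite /series/= mulr_sumr.
by apply: cvgM => //; exact: cvg_cst.
Qed.

(** Convergence is asked of the scaled series, which is what [laplace_at_series] supplies; for
    [c = 0] both sides are 0 whatever [limn] returns on [u]. *)
Lemma limn_seriesZ (c : R) (u : nat -> R) :
  cvgn (series (fun n => c * u n)) ->
  limn (series (fun n => c * u n)) = c * limn (series u).
Proof.
have [->|c0 cu] := eqVneq c 0.
  move=> _; rewrite mul0r; apply: cvg_lim => //.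
  apply: cvg_near_cst; near=> n.
  by rewrite /series/=; apply: big1 => k _; rewrite mul0r.
have uE : u = (c^-1 *: (fun n => c * u n)).
  by apply/funext => n; rewrite -[RHS]/(c^-1 * (c * u n)) mulKf.
have e : limn (series u) = c^-1 * limn (series (fun n => c * u n)).
  by rewrite {1}uE lim_seriesZ.
by rewrite e mulVKf.
Unshelve. all: end_near. Qed.

Lemma is_cvg_seriesV (c : R) (u : nat -> R) : c != 0 ->
  cvgn (series (fun n => c * u n)) -> cvgn (series u).
Proof.
move=> c0 cu; have -> : u = (c^-1 *: (fun n => c * u n)).
  by apply/funext => n; rewrite -[RHS]/(c^-1 * (c * u n)) mulKf.
exact: is_cvg_seriesZ.
Qed.

Variables (lambda theta alpha : R).
Hypotheses (lambda_gt0 : 0 < lambda) (theta_gt0 : 0 < theta)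
  (alpha_gt0 : 0 < alpha).

Let inner (t : R) (q r : nat) : R := (- (lambda * powR t alpha)) ^+ r *
  ML3 alpha (r%:R * alpha + q%:R + 1) r%:R (powR theta alpha * powR t alpha).
Let outer (t : R) (q : nat) : R := (theta * t) ^+ q * limn (series (inner t q)).

(** The exponent of [t] in the term of index [(q, r, j)]. Its Gamma factor is [Gamma (b + 1)], so
    each term transforms into a pure power of [z]; the factor [(theta t)^q] is absorbed into [base]
    for this reason. *)
Let b (q r j : nat) : R := alpha * j%:R + (r%:R * alpha + q%:R).
Let c (q r j : nat) : R :=
  theta ^+ q * (- lambda) ^+ r * (negbin R r j * powR theta alpha ^+ j).
Let base (q r j : nat) (t : R) : R :=
  c q r j * (powR t (b q r j) / Gamma (b q r j + 1)).

Let b_ge0 q r j : 0 <= b q r j.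
Proof. by rewrite /b !addr_ge0 ?mulr_ge0 ?(ltW alpha_gt0). Qed.

Let powRb q r j (t : R) : 0 <= t ->
  powR t (b q r j) = powR t alpha ^+ j * (powR t alpha ^+ r * t ^+ q).
Proof.
move=> t0; have a0 := ltW alpha_gt0.
rewrite /b !powRDn ?addr_ge0 ?mulr_ge0//.
by rewrite [r%:R * _]mulrC !powRrM !powR_mulrn ?powR_ge0.
Qed.

Let baseE q r j (t : R) : 0 <= t ->
  base q r j t = ((theta * t) ^+ q * (- (lambda * powR t alpha)) ^+ r) *
    (pochhammer r%:R j * (powR theta alpha * powR t alpha) ^+ j /
      ((j`!)%:R * Gamma (alpha * j%:R + (r%:R * alpha + q%:R + 1)))).
Proof.
move=> t0; rewrite /base /c powRb// addrA -/(b q r j) -addrA -/(b q r j).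
rewrite -!mulNr !exprMn /negbin invfM; ring.
Qed.

Let powRNb q r j (z : R) : 0 < z -> powR z (- b q r j) =
  (z^-1) ^+ q * (powR z alpha)^-1 ^+ r * (powR z alpha)^-1 ^+ j.
Proof. by move=> z0; rewrite powRN powRb ?ltW// !invfM -!exprVn; ring. Qed.

Let powRNb1 q r j (z : R) : 0 < z -> powR z (- (b q r j + 1)) =
  z^-1 * powR z (- b q r j).
Proof.
by move=> z0; rewrite !powRN powRDn// powRr1 ?ltW// invfM mulrC.
Qed.

(** The ratios of the sums over [j] and [r]. Since [w z = lambda / (z^alpha - theta^alpha)], the
    condition [z0_large] below is what gives [w z0 < 1], and it implies [rho z0 < 1]. *)
Let rho (z : R) := powR theta alpha / powR z alpha.
Let w (z : R) := lambda / powR z alpha * (1 - rho z)^-1.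

Variable z0 : R.
Hypotheses (theta_z0 : theta < z0)
  (z0_large : powR theta alpha + lambda < powR z0 alpha).

Let z00 : 0 < z0. Proof. exact: lt_trans theta_z0. Qed.

Let large z : z0 <= z -> powR theta alpha + lambda < powR z alpha.
Proof.
move=> zz; apply: (lt_le_trans z0_large); apply: ge0_ler_powR => //.
- exact: ltW.
- by rewrite nnegrE ltW.
- by rewrite nnegrE (le_trans _ zz)// ltW.
Qed.

Let rho01 z : z0 <= z -> 0 <= rho z < 1.
Proof.
move=> zz; have := large zz => L.
have t0 : 0 < powR theta alpha by rewrite powR_gt0.
have p0 : 0 < powR z alpha by apply: lt_trans L; rewrite addr_gt0.
apply/andP; split; first by rewrite /rho divr_ge0// ltW.
by have l0 := lambda_gt0; rewrite /rho ltr_pdivrMr// mul1r; lra.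
Qed.

Let w01 z : z0 <= z -> 0 <= w z < 1.
Proof.
move=> zz; have := large zz => L; have /andP[r0 r1] := rho01 zz.
have t0 : 0 < powR theta alpha by rewrite powR_gt0.
have p0 : 0 < powR z alpha by apply: lt_trans L; rewrite addr_gt0.
rewrite /w mulr_ge0 ?divr_ge0 ?invr_ge0 ?subr_ge0 ?ltW//=.
rewrite ltr_pdivrMr ?subr_gt0// mul1r ltr_pdivrMr// mulrBl mul1r /rho divfK ?gt_eqF//.
by rewrite ltrBrDl.
Qed.

(** The same sum over [j] twice: [K1] with absolute values at [z0] and [e] in place of [1 / z], [F1]
    with signs at [z]. Likewise for [K2] and [F2] with the sum over [r]. *)
Let K1 q r : R := expR 1 * (theta / z0) ^+ q * w z0 ^+ r.
Let F1 q r z : R := z^-1 * (theta / z) ^+ q * (- w z) ^+ r.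

Let layer1 q r :
  (forall t, 0 <= t -> cvgn (series (fun j => base q r j t))) /\
  laplace_at z0 (K1 q r) (fun t => (theta * t) ^+ q * inner t q r) (F1 q r).
Proof.
apply: (@laplace_at_series _ _ _ _ _
  (fun j => `|c q r j| * (expR 1 * powR z0 (- b q r j)))
  (base q r) (fun j z => c q r j * powR z (- (b q r j + 1)))).
- exact: ltW.
- move=> j; apply: laplace_atZ; exact: laplace_at_powR.
- have -> : (fun j => `|c q r j| * (expR 1 * powR z0 (- b q r j))) =
      (fun j => (expR 1 * (theta / z0) ^+ q * (lambda / powR z0 alpha) ^+ r) *
        (negbin R r j * rho z0 ^+ j)).
    apply/funext => j; rewrite powRNb// /c.
    have := negbin_ge0 R r j; move: (negbin R r j) => p p0.
    rewrite !normrM (ger0_norm p0) !normrX normrN !gtr0_norm ?powR_gt0//.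
    by rewrite /rho !exprMn; ring.
  rewrite /K1 (_ : w z0 ^+ r = (lambda / powR z0 alpha) ^+ r *
    (1 - rho z0)^-1 ^+ r) ?mulrA; last by rewrite /w exprMn.
  by apply: cvg_seriesZ; apply: cvg_negbin_series; exact: rho01.
- move=> z zz; have z1 := lt_trans z00 zz.
  have -> : (fun j => c q r j * powR z (- (b q r j + 1))) =
      (fun j => (z^-1 * (theta / z) ^+ q * (- lambda / powR z alpha) ^+ r) *
        (negbin R r j * rho z ^+ j)).
    apply/funext => j; rewrite powRNb1// powRNb// /c.
    by rewrite /rho !exprMn; ring.
  rewrite /F1 (_ : (- w z) ^+ r = (- lambda / powR z alpha) ^+ r *
    (1 - rho z)^-1 ^+ r) ?mulrA; last by rewrite /w -!mulNr exprMn.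
  by apply: cvg_seriesZ; apply: cvg_negbin_series; apply: rho01; exact: ltW.
- move=> t t0 cb.
  have bE : (fun j => base q r j t) = (fun j =>
      ((theta * t) ^+ q * (- (lambda * powR t alpha)) ^+ r) *
      (pochhammer r%:R j * (powR theta alpha * powR t alpha) ^+ j /
      ((j`!)%:R * Gamma (alpha * j%:R + (r%:R * alpha + q%:R + 1))))).
    by apply/funext => j; rewrite baseE.
  by rewrite [in RHS]bE limn_seriesZ -?bE// mulrA.
Qed.

Let K2 q : R := expR 1 * (theta / z0) ^+ q * (1 - w z0)^-1.
Let F2 q z : R := z^-1 * (theta / z) ^+ q * (1 + w z)^-1.

Let layer2 q :
  (forall t, 0 <= t -> cvgn (series (inner t q))) /\
  laplace_at z0 (K2 q) (fun t => outer t q) (F2 q).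
Proof.
have [|||cs ?] := @laplace_at_series _ z0 (K2 q) (fun t => outer t q) (F2 q)
  (K1 q) (fun r t => (theta * t) ^+ q * inner t q r) (F1 q) (ltW z00)
  (fun r => proj2 (layer1 q r)).
- have := @cvg_geometric_series _ (expR 1 * (theta / z0) ^+ q) (w z0).
  by apply; have /andP[w0 w1] := w01 (lexx z0); rewrite ger0_norm.
- move=> z zz; rewrite /F2.
  have := @cvg_geometric_series _ (z^-1 * (theta / z) ^+ q) (- w z).
  by rewrite opprK; apply; have /andP[w0 w1] := w01 (ltW zz); rewrite normrN ger0_norm.
- by move=> t t0 cb; rewrite limn_seriesZ.
(* [cs] gives convergence after scaling by [(theta t)^q]. This factor vanishes only at [t = 0],
   where all terms with [r > 0] are zero. *)
split=> // t t0; have [h|h] := eqVneq ((theta * t) ^+ q) 0; last first.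
  exact: is_cvg_seriesV h (cs t t0).
have t00 : t = 0.
  by move/eqP: h; rewrite expf_eq0 mulf_eq0 gt_eqF//= => /andP[_ /eqP].
apply/cvg_ex; exists (inner t q 0); rewrite -(cvg_shiftS (series _)).
apply: cvg_near_cst; near=> n; rewrite /series/= big_nat_recl//= big1 ?addr0//.
by move=> k _; rewrite /inner t00 powR0 ?gt_eqF// mulr0 oppr0 exprS !mul0r.
Unshelve. all: end_near. Qed.

Lemma laplace_at_mittag_leffler :
  (forall t, 0 <= t -> forall q, cvgn (series (inner t q))) /\
  (forall t, 0 <= t -> cvgn (series (outer t))) /\
  laplace_at z0 (expR 1 * (1 - w z0)^-1 * (1 - theta / z0)^-1)
    (fun t => limn (series (outer t)))
    (fun z => (z - theta)^-1 * ((powR z alpha - powR theta alpha) /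
       (powR z alpha - powR theta alpha + lambda))).
Proof.
split; first by move=> t t0 q; apply: (layer2 q).1.
have lz z : z0 <= z -> `|theta / z| < 1.
  move=> zz; have z1 := lt_le_trans z00 zz.
  by rewrite ger0_norm ?divr_ge0 ?ltW// ltr_pdivrMr// mul1r (lt_le_trans theta_z0).
apply: (@laplace_at_series _ z0 _ _ _ K2 (fun q t => outer t q) F2 (ltW z00)
  (fun q => proj2 (layer2 q))) => //.
- have := @cvg_geometric_series _ (expR 1 * (1 - w z0)^-1) (theta / z0).
  rewrite (_ : geometric _ _ = K2); first by apply; exact: lz.
  by apply/funext => q; rewrite /geometric/= /K2; ring.
- move=> z zz; have z1 := lt_trans z00 zz.
  have := @cvg_geometric_series _ (z^-1 * (1 + w z)^-1) (theta / z).
  rewrite (_ : geometric _ _ = F2 ^~ z); last first.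
    by apply/funext => q; rewrite /geometric/= /F2; ring.
  move=> /(_ (lz _ (ltW zz))).
  (* The sum over [q] turns [1 / z] into [1 / (z - theta)], and [1 / (1 + w z)] is the remaining
     quotient. *)
  rewrite (_ : _ / (1 - theta / z) = (z - theta)^-1 *
    ((powR z alpha - powR theta alpha) /
     (powR z alpha - powR theta alpha + lambda)))//.
  have L := large (ltW zz); have t0 : 0 < powR theta alpha by rewrite powR_gt0.
  rewrite /w /rho; move: (powR z alpha) (powR theta alpha) L t0 => x y L y0.
  have l0 := lambda_gt0; have tz : theta < z by exact: lt_trans zz.
  field; rewrite !gt_eqF//=; lra.
Qed.

End mittag_leffler.

(** * Survival functions, grids and independence *)

Section survival.
Variables (d : measure_display) (T : measurableType d) (R : realType)
  (P : probability T R).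
Notation mu := (@lebesgue_measure R).
Notation Rpos := (`]0, +oo[%classic : set R).

Lemma prob_integrable (f : T -> R) (M : R) : measurable_fun setT f ->
  (forall w, `|f w| <= M) -> P.-integrable setT (EFin \o f).
Proof.
move=> mf fM; apply: measurable_bounded_integrable => //.
  by rewrite ltey_eq fin_num_measure.
exists M; split; first exact: num_real.
by move=> y My w _; exact: le_trans (fM w) (ltW My).
Qed.

Lemma prob_fin (A : set T) : measurable A -> P A = (fine (P A))%:E.
Proof. by move=> mA; rewrite fineK// fin_num_measure. Qed.

Lemma fine_prob01 (A : set T) : measurable A -> 0 <= fine (P A) <= 1.
Proof.
move=> mA; rewrite fine_ge0//= -lee_fin -prob_fin//; exact: probability_le1.
Qed.

Lemma Rintegral_prob_indic (A : set T) : measurable A ->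
  \int[P]_w \1_A w = fine (P A).
Proof. by move=> mA; rewrite /Rintegral integral_indic// setIT. Qed.

Lemma Rintegral_prob_cst (c : R) : \int[P]_w c = c.
Proof.
rewrite Rintegral_cst// -[X in _ = X]mulr1; congr (_ * _).
exact: (congr1 fine (probability_setT P)).
Qed.

Lemma prob_cvg (f_ : nat -> T -> R) (f : T -> R) (A : set T) (M : R) :
  (forall n, measurable_fun setT (f_ n)) -> measurable_fun setT f ->
  measurable A -> P (~` A) = 0%E ->
  (forall w, A w -> f_ ^~ w @ \oo --> f w) ->
  (forall n w, `|f_ n w| <= M) ->
  (fun n => \int[P]_w f_ n w) @ \oo --> \int[P]_w f w.
Proof.
move=> mf_ mf mA A1 ff fM.
have iM : P.-integrable setT (EFin \o (fun _ : T => M)).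
  by apply: (@prob_integrable _ `|M|).
have [|||||intf _ cv] := @dominated_convergence _ _ _ P setT measurableT
  (fun n => EFin \o f_ n) (EFin \o f) (EFin \o (fun=> M)).
- by move=> n; exact/measurable_EFinP.
- exact/measurable_EFinP.
- exists (~` A); split=> //; first exact: measurableC.
  move=> w /= h Aw; apply: h => _.
  by apply: cvg_EFin; [exact: nearW|exact: ff].
- exact: iM.
- by apply: aeW => x n Dx /=; rewrite lee_fin fM.
rewrite /Rintegral; apply: fine_cvg.
by rewrite fineK//; exact: integrable_fin_num.
Qed.

Variables (X : T -> R) (mX : measurable_fun setT X).

Lemma measurable_gt_set (t : R) : measurable [set w | t < X w].
Proof.
rewrite (_ : [set _ | _] = X @^-1` `]t, +oo[); last first.
  by apply/seteqP; split=> w /=; rewrite in_itv/= andbT.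
by rewrite -[X in measurable X]setTI; apply: mX.
Qed.

Definition survival (t : R) : R := fine (P [set w | t < X w]).

(** Lets [survival] inherit measurability and right-continuity from [cdf]. *)
Lemma survival_cdf : exists Y : {RV P >-> R},
  survival = fun t => 1 - fine (cdf Y t).
Proof.
exists (mfun_Sub (mem_set mX)); apply/funext => t.
have e : [set w | t < X w] = ~` (X @^-1` `]-oo, t]).
  by apply/seteqP; split=> w /=; rewrite in_itv/=; [move/lt_geF=> ->|move/negP; rewrite -ltNge].
rewrite /survival e probability_setC; last by rewrite -[X in measurable X]setTI; apply: mX.
by rewrite fineB// fin_num_measure// -[X in measurable X]setTI; apply: mX.
Qed.

Lemma measurable_survival : measurable_fun setT survival.
Proof.
have [Y ->] := survival_cdf; apply: measurable_funB => //.
by apply: measurableT_comp => //; exact: cdf_measurable.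
Qed.

Lemma survival_right_continuous (t : R) : survival x @[x --> t^'+] --> survival t.
Proof.
have [Y ->] := survival_cdf; apply: cvgB; first exact: cvg_cst.
apply: fine_cvg; rewrite fineK; first exact: cdf_right_continuous.
by rewrite fin_num_measure.
Qed.

Lemma survival01 (t : R) : 0 <= survival t <= 1.
Proof. exact/fine_prob01/measurable_gt_set. Qed.

Lemma integral_expR_itv (s x : R) : 0 < s -> 0 <= x ->
  (\int[mu]_(t in `]0%R, x[) (s * expR (- (s * t)))%:E =
   (1 - expR (- (s * x)))%:E)%E.
Proof.
move=> s0; rewrite le_eqVlt => /predU1P[<-|x0].
  by rewrite set_itvoo0 integral_set0 mulr0 oppr0 expR0 subrr.
have mf (D : set R) : measurable_fun D (fun t => s * expR (- (s * t))).
  by apply: measurable_funM => //; exact: measurable_expRN.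
rewrite (@integral_itv_obnd_cbnd _ _ (BLeft x)); last by apply/measurable_EFinP; exact: mf.
rewrite (@integral_itv_bndo_bndc _ (BLeft 0)); last by apply/measurable_EFinP; exact: mf.
rewrite EFinB -mulNr -(exponential_prob_itv0c _ x0).
apply: eq_integral => t; rewrite inE/= in_itv/= => /andP[t0 _].
by rewrite exponential_pdfE ?(ltW s0)// mulNr.
Qed.

(* Tonelli on [s e^(-st) 1_(0 < t < X)]. *)
Lemma laplace_survival (s : R) : (forall w, 0 <= X w) -> 0 < s ->
  \int[P]_w expR (- (s * X w)) =
  1 - s * \int[mu]_(t in Rpos) (expR (- (s * t)) * survival t).
Proof.
move=> X0 s0.
have mexp : measurable_fun setT (fun w => expR (- (s * X w))).
  by apply: measurableT_comp => //; apply: measurable_funN; exact: measurable_funM.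
have exp01 w : `|expR (- (s * X w))| <= 1.
  by rewrite ger0_norm ?expR_ge0// -expR0 ler_expR oppr_le0 mulr_ge0// ltW.
pose f (z : T * R) : R := s * expR (- (s * z.2)) * (0 < z.2 < X z.1)%R%:R.
have f0 z : 0 <= f z by rewrite !mulr_ge0 ?expR_ge0 ?(ltW s0).
have mf : measurable_fun setT (EFin \o f).
  apply/measurable_EFinP; apply: measurable_funM.
    apply: measurable_funM => //; apply: measurableT_comp => //.
    by apply: measurable_funN; apply: measurable_funM => //; exact: measurable_snd.
  apply: measurableT_comp => //; apply: measurable_and.
    by apply: measurable_fun_ltr => //; exact: measurable_snd.
  apply: measurable_fun_ltr; first exact: measurable_snd.
  by apply: measurableT_comp => //; exact: measurable_fst.
have := @fubini_tonelli _ _ _ _ R P mu _ mf (fun z => f0 z).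
have -> : (\int[P]_w \int[mu]_t (EFin \o f) (w, t) =
    \int[P]_w (1 - expR (- (s * X w)))%:E)%E.
  apply: eq_integral => w _; rewrite -integral_expR_itv// [RHS]integral_mkcond.
  apply: eq_integral => t _; rewrite /f patchE mem_setE in_itv/=.
  by case: ifP => _; rewrite ?mulr1 ?mulr0.
have -> : (\int[mu]_t \int[P]_w (EFin \o f) (w, t) =
    \int[mu]_(t in Rpos) (s * (expR (- (s * t)) * survival t))%:E)%E.
  rewrite [RHS]integral_mkcond; apply: eq_integral => t _.
  rewrite patchE mem_setE in_itv/= andbT; case: ifPn => [t0|t0].
    transitivity (\int[P]_w ((s * expR (- (s * t)))%:E *
        (\1_[set w | t < X w] w)%:E))%E.
      by apply: eq_integral => w _; rewrite /= /f t0/= indicE mem_setE EFinM.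
    rewrite ge0_integralZl//; last by rewrite lee_fin mulr_ge0 ?expR_ge0 ?ltW.
    rewrite integral_indic ?setIT; last exact: measurable_gt_set.
    rewrite [X in (_ * X)%E](_ : _ = (survival t)%:E).
      by rewrite -EFinM mulrA.
    exact: prob_fin (measurable_gt_set t).
    exact: measurableT.
    apply/measurable_EFinP; apply: measurable_indic; exact: measurable_gt_set.
  transitivity (0 : \bar R) => //; apply: integral0_eq => w _.
  by rewrite /= /f (negbTE t0)/= mulr0.
move=> /(congr1 fine); rewrite -!/(Rintegral _ _ _) RintegralB//; last 2 first.
  by apply: (@prob_integrable _ 1) => // w; rewrite normr1.
  exact: prob_integrable exp01.
rewrite Rintegral_prob_cst RintegralZl//; last first.
  have [ie _] := integrable_expRN s0.
  have mD : measurable (Rpos : set (measurableTypeR R)) by exact: measurable_itv.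
  apply: (integrable_bounded_mul (M := 1) mD ie).
    by apply: measurable_funTS; exact: measurable_survival.
  by move=> t _; have /andP[a b] := survival01 t; rewrite ger0_norm.
by move=> /= h; lra.
Qed.

End survival.

(** * Right-continuous functions are determined by their integrals *)

Section right_continuous_uniqueness.
Variable R : realType.
Notation mu := (@lebesgue_measure R).
Notation Rpos := (`]0, +oo[%classic : set R).

Lemma indic_ltE (x u : R) : \1_[set y | y < x] u = (u < x)%R%:R :> R.
Proof. by rewrite indicE; congr (nat_of_bool _)%:R; apply/idP/idP; rewrite inE. Qed.

(** If [h t > 0], then [h >= h t / 2] on some []t, t + e[], yet the integral there is a difference
    of two vanishing integrals. *)
Lemma right_cont_ge0 (h : R -> R) (t : R) :
  mu.-integrable Rpos (EFin \o h) -> 0 <= t ->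
  h x @[x --> t^'+] --> h t ->
  (forall x, \int[mu]_(u in Rpos) (h u * \1_[set y | y < x] u) = 0) ->
  h t <= 0.
Proof.
move=> ih t0 hr hI; rewrite leNgt; apply/negP => ht0.
have h2 : 0 < h t / 2 by rewrite divr_gt0.
have [e /= e0 he] := (cvgrPdist_le _ _).1 hr _ h2.
have mD : measurable (Rpos : set (measurableTypeR R)) by exact: measurable_itv.
have mi (A : set R) : measurable A -> measurable_fun Rpos (\1_A : R -> R).
  by move=> mA; apply: measurable_funTS; exact: measurable_indic.
have mlt x : measurable [set y : R | y < x].
  by rewrite (_ : [set y | _] = `]-oo, x[%classic).
have iI x : mu.-integrable Rpos (EFin \o (fun u => h u * \1_[set y | y < x] u)).
  apply: (integrable_bounded_mul (M := 1) mD ih); first by apply: mi; exact: mlt.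
  by move=> u _; rewrite indicE; case: (_ \in _); rewrite /= ?normr1 ?normr0.
pose J := `]t, t + e[%classic : set R.
have mJ : measurable J by exact: measurable_itv.
have JR : J `<=` Rpos.
  by move=> x; rewrite /J /= !in_itv/= andbT => /andP[+ _]; exact: le_lt_trans.
have muJ : fine (mu J) = e.
  by rewrite /J lebesgue_measure_itv/= lte_fin ltrDl e0 -EFinB /= addrC addKr.
have muJoo : (mu J < +oo)%E.
  by rewrite /J lebesgue_measure_itv/= lte_fin ltrDl e0 -EFinB ltry.
have I0 : \int[mu]_(u in J) h u = 0.
  have : \int[mu]_(u in Rpos) (h u * \1_[set y | y < t + e] u) -
      \int[mu]_(u in Rpos) (h u * \1_[set y | y < t] u) = 0.
    by rewrite !hI subrr.
  rewrite -RintegralB//.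
  (* The difference of the two rays is [[t, t + e[]; its left endpoint is negligible, and for
     [t = 0] it lies outside [Rpos]. *)
  have e1 : \int[mu]_(u in J) h u = \int[mu]_(u in `[t, (t + e)[ `&` Rpos) h u.
    have [t00|tp] := eqVneq t 0.
      congr Rintegral; apply/seteqP; rewrite /J t00; split=> x /=;
        rewrite !in_itv/= !andbT; first by move=> /andP[x0 ->]; rewrite x0 ltW.
      by case=> /andP[_ ->] ->.
    have {}tp : 0 < t by rewrite lt_def tp.
    have -> : `[t, (t + e)[ `&` Rpos = `[t, (t + e)[%classic :> set R.
      apply/setIidPl => x /=; rewrite !in_itv/= andbT => /andP[+ _].
      exact: lt_le_trans.
    rewrite /J Rintegral_itv_obnd_cbnd//; exact: integrableS ih.
  move=> <-; rewrite e1 Rintegral_mkcondl; apply: eq_Rintegral => u _.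
  rewrite patchE mem_setE in_itv/= !indic_ltE.
  have [ut|tu] := ltP u t.
    by rewrite (lt_trans ut) ?ltrDl//= subrr.
  by case: ifP => /= [->|->]; rewrite ?mulr1 !mulr0 subr0.
have : h t / 2 * e <= 0.
  rewrite -I0 -[X in _ * X]muJ -Rintegral_cst//; apply: le_Rintegral => //.
  - by apply: measurable_bounded_integrable => //; exact: bounded_cst.
  - exact: integrableS ih.
  - move=> u; rewrite /J /= in_itv/= => /andP[tu ute].
    have : `|h t - h u| <= h t / 2.
      by apply: he => //=; rewrite ltr_distlC; apply/andP; split; lra.
    by rewrite ler_norml => /andP[a b]; lra.
by rewrite leNgt mulr_gt0.
Qed.

Lemma right_cont_eq (f g : R -> R) :
  mu.-integrable Rpos (EFin \o f) -> mu.-integrable Rpos (EFin \o g) ->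
  (forall t, 0 <= t -> f x @[x --> t^'+] --> f t) ->
  (forall t, 0 <= t -> g x @[x --> t^'+] --> g t) ->
  (forall x, \int[mu]_(u in Rpos) (f u * \1_[set y | y < x] u) =
             \int[mu]_(u in Rpos) (g u * \1_[set y | y < x] u)) ->
  forall t, 0 <= t -> f t = g t.
Proof.
have mD : measurable (Rpos : set (measurableTypeR R)) by exact: measurable_itv.
suff H f1 g1 : mu.-integrable Rpos (EFin \o f1) ->
    mu.-integrable Rpos (EFin \o g1) ->
    (forall t, 0 <= t -> f1 x @[x --> t^'+] --> f1 t) ->
    (forall t, 0 <= t -> g1 x @[x --> t^'+] --> g1 t) ->
    (forall x, \int[mu]_(u in Rpos) (f1 u * \1_[set y | y < x] u) =
               \int[mu]_(u in Rpos) (g1 u * \1_[set y | y < x] u)) ->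
    forall t, 0 <= t -> f1 t <= g1 t.
  move=> i1 i2 r1 r2 e t t0; apply/eqP; rewrite eq_le !H// => x; exact: esym.
move=> i1 i2 r1 r2 e t t0; rewrite -subr_le0.
have iI (k : R -> R) x : mu.-integrable Rpos (EFin \o k) ->
    mu.-integrable Rpos (EFin \o (fun u => k u * \1_[set y | y < x] u)).
  move=> ik; apply: (integrable_bounded_mul (M := 1) mD ik).
    apply: measurable_funTS; apply: measurable_indic.
    by rewrite (_ : [set y | _] = `]-oo, x[%classic).
  by move=> u _; rewrite indicE; case: (_ \in _); rewrite /= ?normr1 ?normr0.
apply: (@right_cont_ge0 (fun u => f1 u - g1 u)) => //.
- by have := integrableB mD i1 i2; apply: eq_integrable.
- by apply: cvgB; [exact: r1|exact: r2].
- move=> x; under eq_Rintegral do rewrite mulrBl.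
  by rewrite RintegralB ?e ?subrr//; exact: iI.
Qed.

End right_continuous_uniqueness.

(** * Rounding down to a finite grid *)

Section discretization.
Variable R : realType.

(** As a sum of indicators it is readily measurable, and the cap [M] leaves finitely many values.
    The strict inequality keeps the rounded time strictly below a positive [e], as left limits
    require. *)
Definition grid_count (m M : nat) (e : R) : nat :=
  \sum_(k < M) (k.+1%:R < m%:R * e)%R.

(* Largest grid point [k / n.+1 < e] with [k <= n.+1 ^ 2], and [0] if [e <= 0]. *)
Definition grid_floor (n : nat) (e : R) : R :=
  (grid_count n.+1 (n.+1 ^ 2) e)%:R / n.+1%:R.

Lemma grid_count_le m M e : (grid_count m M e <= M)%N.
Proof.
apply: (@leq_trans (\sum_(k < M) 1)%N); last by rewrite sum1_card card_ord.
by apply: leq_sum => k _; case: (_ < _).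
Qed.

Lemma grid_count_spec m M e : 0 < m%:R * e ->
  (grid_count m M e)%:R < m%:R * e /\
  (grid_count m M e = M \/ m%:R * e <= (grid_count m M e).+1%:R).
Proof.
move=> a0; elim: M => [|M [IH1 IH2]].
  by rewrite /grid_count big_ord0; split=> //; left.
have cS : grid_count m M.+1 e = (grid_count m M e + (M.+1%:R < m%:R * e)%R)%N.
  by rewrite /grid_count big_ord_recr.
have [aM|Ma] := ltP M.+1%:R (m%:R * e).
  have cM : grid_count m M e = M.
    case: IH2 => // h; have := lt_le_trans aM h; rewrite ltr_nat ltnS => h'.
    by have := leq_ltn_trans (grid_count_le m M e) h'; rewrite ltnn.
  by rewrite cS aM cM addn1; split=> //; left.
have e0 : (M.+1%:R < m%:R * e) = false by apply/negbTE; rewrite -leNgt.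
rewrite cS e0 addn0; split=> //; right.
by case: IH2 => // ->.
Qed.

Lemma grid_floor_ge0 n e : 0 <= grid_floor n e.
Proof. by rewrite divr_ge0. Qed.

Lemma grid_floor_le0 n e : e <= 0 -> grid_floor n e = 0.
Proof.
move=> e0; rewrite /grid_floor /grid_count big1 ?mul0r// => k _.
by rewrite ltNge (le_trans (_ : _ <= 0))// mulr_ge0_le0.
Qed.

Lemma grid_floor_lt n e : 0 < e -> grid_floor n e < e.
Proof.
move=> e0; rewrite /grid_floor ltr_pdivrMr// mulrC.
by have [] := @grid_count_spec n.+1 (n.+1 ^ 2) e (mulr_gt0 (ltr0Sn _ _) e0).
Qed.

Lemma grid_floor_le n e : 0 <= e -> grid_floor n e <= e.
Proof.
rewrite le_eqVlt => /predU1P[<-|e0]; first by rewrite grid_floor_le0.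
exact/ltW/grid_floor_lt.
Qed.

Lemma grid_floor_ge n e : 0 < e -> e <= n.+1%:R ->
  e - n.+1%:R^-1 <= grid_floor n e.
Proof.
move=> e0 en; have m0 : (0 : R) < n.+1%:R by [].
have [c1 [c2|c2]] := @grid_count_spec n.+1 (n.+1 ^ 2) e (mulr_gt0 m0 e0).
  move: c1; rewrite c2 natrX expr2 ltr_pM2l// => /(le_lt_trans en).
  by rewrite ltxx.
rewrite /grid_floor ler_pdivlMr// mulrBl mulVf ?gt_eqF// lerBlDr natr1 mulrC.
exact: c2.
Qed.

Lemma cvg_grid_floor e : 0 <= e -> grid_floor ^~ e @ \oo --> e.
Proof.
rewrite le_eqVlt => /predU1P[<-|e0].
  under eq_fun do rewrite grid_floor_le0//; exact: cvg_cst.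
apply: (@squeeze_cvgr _ _ _ _ (fun n => e - n.+1%:R^-1) (fun=> e)).
- near=> n; apply/andP; split; last exact/grid_floor_le/ltW.
  apply: grid_floor_ge => //.
  apply: (@le_trans _ _ n%:R); last by rewrite ler_nat.
  by near: n; exact: nbhs_infty_ger.
- rewrite -[X in _ --> X]subr0; apply: cvgB; first exact: cvg_cst.
  exact: cvg_harmonic.
- exact: cvg_cst.
Unshelve. all: end_near. Qed.

Lemma grid_floorE n e : grid_floor n e =
  \sum_(k < n.+1 ^ 2) n.+1%:R^-1 *
    \1_[set x : R | k.+1%:R < n.+1%:R * x] e.
Proof.
rewrite /grid_floor /grid_count natr_sum mulr_suml; apply: eq_bigr => k _.
rewrite mulrC indicE; congr (_ * (nat_of_bool _)%:R).
by apply/idP/idP; rewrite inE.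
Qed.

Lemma measurable_grid_count m M : measurable_fun setT (grid_count m M : R -> nat).
Proof.
rewrite /grid_count; elim: M => [|M IH].
  by under eq_fun do rewrite big_ord0; exact: measurable_cst.
under eq_fun do rewrite big_ord_recr/=.
apply: measurable_fun_addn => //.
apply: measurableT_comp => //.
by apply: measurable_fun_ltr => //; exact: mulrl_measurable.
Qed.

End discretization.

(** * From independent events to products of integrals, and from rays to Borel sets *)

Section independence.
Variables (d : measure_display) (T : measurableType d) (R : realType)
  (P : probability T R).

(** Extends a factorisation from indicators to [g] by the simple functions [grid_floor n] of [g] and
    dominated convergence; the case [Z = 1], [c = 1] of the same formula evaluates the right-hand
    side. *)
Lemma weighted_indep (Z X : T -> R) (c : R) (g : R -> R) :
  measurable_fun setT Z -> (forall w, `|Z w| <= 1) -> measurable_fun setT X ->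
  (forall C, measurable C ->
    \int[P]_w (Z w * \1_C (X w)) = c * fine (P (X @^-1` C))) ->
  measurable_fun setT g -> (forall x, 0 <= g x <= 1) ->
  \int[P]_w (Z w * g (X w)) = c * \int[P]_w g (X w).
Proof.
move=> mZ Z1 mX ZX mg g01.
have mC n k : measurable [set x : R | k.+1%:R < n.+1%:R * g x].
  rewrite (_ : [set _ | _] =
      (fun x => n.+1%:R * g x) @^-1` `]k.+1%:R, +oo[); last first.
    by apply/seteqP; split=> x /=; rewrite in_itv/= andbT.
  by rewrite -[X in measurable X]setTI; apply: measurable_funM.
have pre A : measurable A -> measurable (X @^-1` A).
  by move=> mA; rewrite -[X in measurable X]setTI; exact: mX.
have mI A : measurable A -> measurable_fun setT (fun w => \1_A (X w) : R).
  by move=> mA; apply: measurableT_comp => //; exact: measurable_indic.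
have step (Y : T -> R) (c' : R) n : measurable_fun setT Y ->
    (forall w, `|Y w| <= 1) ->
    (forall C, measurable C ->
      \int[P]_w (Y w * \1_C (X w)) = c' * fine (P (X @^-1` C))) ->
    \int[P]_w (Y w * grid_floor n (g (X w))) =
    \sum_(k < n.+1 ^ 2) n.+1%:R^-1 *
      (c' * fine (P (X @^-1` [set x | k.+1%:R < n.+1%:R * g x]))).
  move=> mY Y1 YX.
  transitivity (\int[P]_w (\sum_(k < n.+1 ^ 2) n.+1%:R^-1 *
      (Y w * \1_[set x | k.+1%:R < n.+1%:R * g x] (X w)))).
    apply: eq_Rintegral => w _; rewrite grid_floorE mulr_sumr.
    by apply: eq_bigr => k _; rewrite mulrCA.
  have iYk (k : nat) : P.-integrable setT
      (EFin \o (fun w => Y w * \1_[set x | k.+1%:R < n.+1%:R * g x] (X w))).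
    apply: (@prob_integrable _ _ _ _ _ 1).
      by apply: measurable_funM => //; exact: mI.
    move=> w; rewrite normrM mulr_ile1// indicE.
    by case: (_ \in _); rewrite /= ?normr1 ?normr0.
  rewrite Rintegral_sum//; last by move=> k; apply: integrableZlr.
  by apply: eq_bigr => k _; rewrite RintegralZl// YX.
have m1 : measurable_fun setT (fun _ : T => (1 : R)) by [].
have X1 C : measurable C -> \int[P]_w (1 * \1_C (X w)) = 1 * fine (P (X @^-1` C)).
  move=> mA; rewrite mul1r -(Rintegral_prob_indic P (pre _ mA)).
  by apply: eq_Rintegral => w _; rewrite mul1r !indicE.
have e n : \int[P]_w (Z w * grid_floor n (g (X w))) =
    c * \int[P]_w (1 * grid_floor n (g (X w))).
  rewrite (step Z c)// (step _ 1)//; last by move=> w; rewrite normr1.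
  rewrite mulr_sumr; apply: eq_bigr => k _; rewrite mul1r; ring.
have mgX : measurable_fun setT (fun w => g (X w)) by exact: measurableT_comp.
have mgf n : measurable_fun setT (fun w => grid_floor n (g (X w))).
  under eq_fun do rewrite grid_floorE.
  apply: measurable_sum => k; apply: measurable_funM => //.
  apply: (measurableT_comp _ mgX); apply: measurable_indic.
  rewrite (_ : [set _ | _] = ( *%R n.+1%:R) @^-1` `]k.+1%:R, +oo[); last first.
    by apply/seteqP; split=> x /=; rewrite in_itv/= andbT.
  by rewrite -[X in measurable X]setTI; apply: mulrl_measurable.
have gX0 w : 0 <= g (X w) by case/andP: (g01 (X w)).
have bgf n w : `|grid_floor n (g (X w))| <= 1.
  rewrite ger0_norm ?grid_floor_ge0// (le_trans (grid_floor_le _ _))//.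
  by case/andP: (g01 (X w)).
have lim (Y : T -> R) : measurable_fun setT Y -> (forall w, `|Y w| <= 1) ->
    (fun n => \int[P]_w (Y w * grid_floor n (g (X w)))) @ \oo -->
    \int[P]_w (Y w * g (X w)).
  move=> mY Y1; apply: (@prob_cvg _ _ _ _ _ _ setT 1) => //.
  - by move=> n; exact: measurable_funM.
  - exact: measurable_funM.
  - by rewrite setCT measure0.
  - by move=> w _; apply: cvgM; [exact: cvg_cst|exact: cvg_grid_floor].
  - by move=> n w; rewrite normrM mulr_ile1.
have l1 := lim Z mZ Z1.
have one1 (w : T) : `|1 : R| <= 1 by rewrite normr1.
have l2 := lim _ m1 one1.
have E : (fun n => \int[P]_w (Z w * grid_floor n (g (X w)))) =
    (fun n => c * \int[P]_w (1 * grid_floor n (g (X w)))).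
  by apply/funext => n; exact: e.
rewrite E in l1.
rewrite (_ : \int[P]_w g (X w) = \int[P]_w (1 * g (X w))); last first.
  by apply: eq_Rintegral => w _; rewrite mul1r.
by apply: (cvg_unique _ l1) => //; apply: cvgM => //; exact: cvg_cst.
Qed.

Lemma prod_indic (I : eqType) (X : I -> T -> R) (J : seq I) (B : I -> set R) w :
  \prod_(i <- J) \1_(B i) (X i w) =
  \1_(\big[setI/setT]_(i <- J) (X i @^-1` B i)) w :> R.
Proof.
elim: J => [|i J IH]; first by rewrite !big_nil indicT.
by rewrite !big_cons IH indicI/= !indicE.
Qed.

Lemma indep_Rintegral (I : eqType) (X : I -> T -> R) (J : seq I)
    (g : I -> R -> R) :
  (forall i, measurable_fun setT (X i)) -> mutually_independent P X -> uniq J ->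
  (forall i, measurable_fun setT (g i)) -> (forall i x, 0 <= g i x <= 1) ->
  \int[P]_w (\prod_(i <- J) g i (X i w)) = \prod_(i <- J) \int[P]_w g i (X i w).
Proof.
move=> mX ind uJ mg g01.
have pre i A : measurable A -> measurable (X i @^-1` A).
  by move=> mA; rewrite -[X in measurable X]setTI; exact: mX.
(* Indicators are replaced by the [g i] one coordinate at a time: [J2] holds those still to be
   replaced, with arbitrary Borel sets so that the induction can add one. *)
suff H J1 J2 B : uniq (J1 ++ J2) -> (forall i, measurable (B i)) ->
    \int[P]_w (\prod_(i <- J1) g i (X i w) * \prod_(i <- J2) \1_(B i) (X i w)) =
    \prod_(i <- J1) (\int[P]_w g i (X i w)) *
    \prod_(i <- J2) fine (P (X i @^-1` B i)).
  have := H J [::] (fun=> setT); rewrite cats0 big_nil mulr1 => <- //.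
  by apply: eq_Rintegral => w _; rewrite big_nil mulr1.
elim: J1 J2 B => [|i J1 IH] J2 B u12 mB.
  under eq_Rintegral do rewrite big_nil mul1r prod_indic.
  rewrite big_nil mul1r Rintegral_prob_indic; first by rewrite ind.
  by apply: bigsetI_measurable => j _; exact: pre.
move: u12; rewrite cat_cons cons_uniq => /andP[iJ u12].
have iJ2 : i \notin J2 by apply: contra iJ; rewrite mem_cat orbC => ->.
have prod01 (s : seq I) (h : I -> R) :
    (forall j, 0 <= h j <= 1) -> 0 <= \prod_(j <- s) h j <= 1.
  move=> h01; apply/andP; split; last exact: prodr_ile1.
  by apply: prodr_ge0 => j _; case/andP: (h01 j).
pose Z w := \prod_(j <- J1) g j (X j w) * \prod_(j <- J2) \1_(B j) (X j w) : R.
have mZ : measurable_fun setT Z.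
  apply: measurable_funM.
    by apply: measurable_prod => j _; exact: measurableT_comp.
  by apply: measurable_prod => j _; apply: measurableT_comp.
have Z1 w : `|Z w| <= 1.
  have /andP[a0 a1] := prod01 J1 (fun j => g j (X j w)) (fun j => g01 j _).
  have /andP[b0 b1] : 0 <= \prod_(j <- J2) (\1_(B j) (X j w) : R) <= 1.
    by apply: prod01 => j; rewrite indicE; case: (_ \in _); rewrite ?lexx ?ler01.
  by rewrite ger0_norm ?mulr_ge0// mulr_ile1.
rewrite [RHS](_ : _ = (\prod_(j <- J1) (\int[P]_w g j (X j w)) *
    \prod_(j <- J2) fine (P (X j @^-1` B j))) * \int[P]_w g i (X i w)); last first.
  by rewrite big_cons; ring.
rewrite -(@weighted_indep Z)//.
  by apply: eq_Rintegral => w _; rewrite big_cons /Z; ring.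
move=> C mC; pose B' j := if j == i then C else B j.
have B'E j : j \in J2 -> B' j = B j.
  by move=> jJ; rewrite /B'; case: eqP => // ji; rewrite -ji jJ in iJ2.
have := IH (i :: J2) B'; rewrite big_cons => IH'.
transitivity (\int[P]_w (\prod_(j <- J1) g j (X j w) *
    \prod_(j <- i :: J2) \1_(B' j) (X j w))).
  apply: eq_Rintegral => w _; rewrite big_cons {1}/B' eqxx /Z.
  have -> : \prod_(j <- J2) \1_(B' j) (X j w) =
      \prod_(j <- J2) \1_(B j) (X j w) :> R.
    by apply: eq_big_seq => j jJ; rewrite B'E.
  ring.
rewrite IH'.
- have -> : \prod_(j <- J2) fine (P (X j @^-1` B' j)) =
      \prod_(j <- J2) fine (P (X j @^-1` B j)).
    by apply: eq_big_seq => j jJ; rewrite B'E.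
  by rewrite /B' eqxx; ring.
- by rewrite -cat1s uniq_catCA/= iJ u12.
- by move=> j; rewrite /B'; case: ifP.
Qed.

(* Passes from rays to Borel sets one coordinate at a time. *)
Lemma ray_indep_ext (A : set T) (X Y : T -> R) (c : R) : measurable A ->
  0 <= c -> measurable_fun setT X -> measurable_fun setT Y ->
  (forall t, P (A `&` X @^-1` [set y | y < t]) =
             (c * fine (P (Y @^-1` [set y | y < t])))%:E) ->
  forall B, measurable B ->
    P (A `&` X @^-1` B) = (c * fine (P (Y @^-1` B)))%:E.
Proof.
move=> mA c0 mX mY h B mB.
have pre (Z : T -> R) C : measurable_fun setT Z -> measurable C ->
    measurable (Z @^-1` C).
  by move=> mZ mC; rewrite -[X in measurable X]setTI; exact: mZ.
pose m1_ := (pushforward (mrestr P mA) X : {measure set R -> \bar R}).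
pose m2_ := (mscale (NngNum c0) (pushforward P Y) : {measure set R -> \bar R}).
pose m1 := m1_ mX; pose m2 := m2_ mY.
have m2E C : measurable C -> m2 C = (c * fine (P (Y @^-1` C)))%:E.
  move=> mC; rewrite EFinM -prob_fin//; exact: pre.
have m1E C : m1 C = P (A `&` X @^-1` C) by rewrite setIC.
rewrite -m2E// -m1E.
apply: (@measure_unique _ R _ (@RGenInftyO.G R)
  (fun k : nat => `]-oo, (k%:R : R)[%classic) _ _ _ _ m1 m2) => //.
- exact: RGenInftyO.measurableE.
- move=> _ _ [x ->] [y ->]; exists (Num.min x y).
  by apply/seteqP; split=> z /=; rewrite !in_itv/= lt_min; [move=> [-> ->]|move/andP].
- by move=> k; exists k%:R.
- apply/seteqP; split=> // x _; exists (Num.bound `|x|) => //=.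
  by rewrite in_itv/= (le_lt_trans (ler_norm x))// archi_boundP.
- move=> _ [x ->].
  rewrite (_ : `]-oo, x[%classic = [set y | y < x]); last first.
    by apply/seteqP; split=> z /=; rewrite in_itv.
  rewrite m1E h m2E//.
  by rewrite (_ : [set y | _] = `]-oo, x[%classic).
- move=> k; rewrite m1E ltey_eq fin_num_measure//.
  by apply: measurableI => //; exact: pre.
Qed.

End independence.

(** * The time-changed arrival process *)

Section first_passage_path.
Variables (R : realType) (D : R -> R).
Hypotheses (D0 : D 0 = 0)
  (D_mono : forall x y, 0 <= x -> x <= y -> D x <= D y).

(* The left limit of [D] at [x > 0]; equal to [sup set0 = 0] for [x <= 0]. *)
Definition left_value (x : R) : R := sup [set D y | y in `[0, x[].

Let Y (t : R) : R := inf [set x | 0 < x /\ t < D x].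
Let arrival (tau : R) : R := inf [set t | 0 <= t /\ tau <= Y t].

Let Y_lb (t : R) : lbound [set x | 0 < x /\ t < D x] 0.
Proof. by move=> x [x0 _]; exact: ltW. Qed.

Let Y_ge0 t : 0 <= Y t.
Proof.
have [S0|/set0P S0] := eqVneq [set x | 0 < x /\ t < D x] set0.
  by rewrite /Y S0 inf0.
exact: lb_le_inf S0 (@Y_lb t).
Qed.

Let Y_le t x : 0 < x -> t < D x -> Y t <= x.
Proof. by move=> x0 tx; apply: ge_inf; [exists 0; exact: Y_lb|]. Qed.

Lemma left_value_ub x y : 0 <= y -> y < x -> D y <= left_value x.
Proof.
move=> y0 yx; apply: ub_le_sup.
  exists (D x) => ? [z + <-]; rewrite /= in_itv/= => /andP[z0 zx].
  by apply: D_mono => //; exact: ltW.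
by exists y => //=; rewrite in_itv/= y0.
Qed.

Lemma left_value_le0 x : x <= 0 -> left_value x = 0.
Proof.
move=> x0; rewrite /left_value set_itv_ge ?image_set0 ?sup0//.
by rewrite bnd_simp -leNgt.
Qed.

Lemma left_value_ge0 x : 0 <= left_value x.
Proof.
have [x0|x0] := leP x 0; first by rewrite left_value_le0.
by rewrite -D0; exact: left_value_ub.
Qed.

Lemma left_value_adherent x e : 0 < x -> 0 < e ->
  exists2 y, 0 <= y < x & left_value x - e < D y.
Proof.
move=> x0 e0.
have hs : has_sup [set D y | y in `[0, x[].
  split; first by exists (D 0), 0 => //=; rewrite in_itv/= lexx.
  exists (D x) => ? [z + <-]; rewrite /= in_itv/= => /andP[z0 zx].
  by apply: D_mono => //; exact: ltW.
have [? [y + <-]] := sup_adherent e0 hs.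
by rewrite /= in_itv/= => yx h; exists y.
Qed.

Lemma cvg_left_value (u : nat -> R) x : 0 < x ->
  (forall n, 0 <= u n < x) -> u @ \oo --> x ->
  (fun n => D (u n)) @ \oo --> left_value x.
Proof.
move=> x0 ux ucv; apply/cvgrPdist_le => e e0.
have [y /andP[y0 yx] h] := left_value_adherent x0 e0.
near=> n; have /andP[un0 unx] := ux n.
have yun : y <= u n.
  by apply: ltW; near: n; exact: (cvgr_gt x ucv).
have h1 := left_value_ub un0 unx; have h2 := D_mono y0 yun.
by rewrite ger0_norm ?subr_ge0//; lra.
Unshelve. all: end_near. Qed.

Let arrival_le0 tau : tau <= 0 -> arrival tau = 0.
Proof.
move=> t0; have A0 : 0 <= (0 : R) /\ tau <= Y 0.
  by split=> //; exact: le_trans (Y_ge0 0).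
apply/eqP; rewrite eq_le; apply/andP; split.
  by apply: ge_inf => //; exists 0 => t [].
by apply: lb_le_inf; [exists 0|move=> t []].
Qed.

(** A level [t] at or above the left limit is not passed before [tau], so [Y t >= tau]; a lower
    level is passed at some [y < tau], so [Y t <= y]. The hypothesis keeps the infimum defining
    [Y (left_value tau)] from being over the empty set, where it would be 0. *)
Lemma first_arrival_val tau : (exists2 x, 0 <= x & left_value tau < D x) ->
  arrival tau = left_value tau.
Proof.
move=> [x x0 hx]; have [t0|t0] := leP tau 0.
  by rewrite left_value_le0// arrival_le0.
have mem : 0 <= left_value tau /\ tau <= Y (left_value tau).
  split; first exact: left_value_ge0.
  have x0' : 0 < x.
    rewrite lt_def x0 andbT; apply: contraTneq hx => ->.
    by rewrite -leNgt D0 left_value_ge0.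
  apply: lb_le_inf; first by exists x.
  move=> y [y0 hy]; rewrite leNgt; apply/negP => yt.
  by have := left_value_ub (ltW y0) yt; rewrite leNgt hy.
apply/eqP; rewrite eq_le; apply/andP; split.
  by apply: ge_inf => //; exists 0 => t [].
apply: lb_le_inf; first by exists (left_value tau).
move=> t [t0' tY]; rewrite leNgt; apply/negP => tl.
have e0 : 0 < left_value tau - t by rewrite subr_gt0.
have [y /andP[y0 yt]] := left_value_adherent t0 e0; rewrite subKr => ty.
have y0' : 0 < y.
  rewrite lt_def y0 andbT; apply: contraTneq ty => ->.
  by rewrite -leNgt D0.
by have := le_lt_trans (Y_le y0' ty) yt; rewrite ltNge tY.
Qed.

(** The complementary case, where [inf set0 = 0] decides. With [first_arrival_val] it describes
    every path, as measurability needs. *)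
Lemma first_arrival_none tau :
  (forall x, 0 <= x -> D x <= left_value tau) -> arrival tau = 0.
Proof.
move=> hD; have [t0|t0] := leP tau 0; first exact: arrival_le0.
rewrite /arrival (_ : [set t | _] = set0) ?inf0//.
apply/seteqP; split=> // t [t0' tY].
have [S0|/set0P[x [x0 tx]]] := eqVneq [set x | 0 < x /\ t < D x] set0.
  by move: tY; rewrite /Y S0 inf0 leNgt t0.
have e0 : 0 < left_value tau - t.
  by rewrite subr_gt0 (lt_le_trans tx)// hD// ltW.
have [y /andP[y0 yt]] := left_value_adherent t0 e0; rewrite subKr => ty.
have y0' : 0 < y.
  rewrite lt_def y0 andbT; apply: contraTneq ty => ->.
  by rewrite -leNgt D0.
by have := le_lt_trans (Y_le y0' ty) yt; rewrite ltNge tY.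
Qed.

End first_passage_path.

Lemma cvg_expR (R : realType) (u : nat -> R) (l : R) :
  u @ \oo --> l -> (fun n => expR (u n)) @ \oo --> expR l.
Proof. by move=> ul; exact: (cvg_comp _ _ ul (@continuous_expR R l)). Qed.

Lemma cvg_prod_ord (R : realType) (n : nat) (u : nat -> nat -> R) (l : nat -> R) :
  (forall i, u i @ \oo --> l i) ->
  (fun m => \prod_(i < n) u i m) @ \oo --> \prod_(i < n) l i.
Proof.
move=> ul; elim: n => [|n IH].
  by under eq_fun do rewrite big_ord0; rewrite big_ord0; exact: cvg_cst.
under eq_fun do rewrite big_ord_recr; rewrite big_ord_recr/=.
by apply: cvgM => //; exact: ul.
Qed.

Lemma prod_ord_mem (R : realType) (J : seq nat) (n : nat) (h : nat -> R) :
  uniq J -> (forall i, i \in J -> (i < n)%N) ->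
  \prod_(i < n) (if (i : nat) \in J then h i else 1) = \prod_(i <- J) h i.
Proof.
move=> uJ Jn; rewrite -(big_mkord xpredT (fun i => if i \in J then h i else 1)).
rewrite -big_mkcond/= -big_filter; apply: perm_big.
apply: uniq_perm => //; first by rewrite filter_uniq// iota_uniq.
move=> i; rewrite mem_filter mem_index_iota/=.
by case: (boolP (i \in J)) => // /Jn ->.
Qed.

(** * Measurability and joint law of the inter-arrival times *)

Section tempered_arrivals.
Variables (R : realType) (d : measure_display) (T : measurableType d)
  (P : probability T R) (lambda theta alpha : R).
Hypotheses (lambda_gt0 : 0 < lambda) (theta_gt0 : 0 < theta)
  (alpha_gt0 : 0 < alpha).
Variables (E : nat -> T -> R) (D : R -> T -> R).
Hypotheses (mE : forall n, measurable_fun setT (E n))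
  (Eexp : forall n (x : R), 0 <= x ->
     P [set w | x < E n w] = (expR (- (lambda * x)))%:E)
  (mD : forall x, measurable_fun setT (D x))
  (D0 : forall w, D 0 w = 0)
  (D_mono : forall w (x y : R), 0 <= x -> x <= y -> D x w <= D y w)
  (D_laplace : forall (s x y : R), 0 <= s -> 0 <= x -> x <= y ->
     (\int[P]_w (expR (- (s * (D y w - D x w))))%:E)%E =
       (expR (- ((y - x) * (powR (s + theta) alpha - powR theta alpha))))%:E)
  (indep : forall x : nat -> R, 0 <= x 0%N -> (forall j, x j <= x j.+1) ->
     mutually_independent P
       (fun i : nat + nat => match i with
                             | inl n => E n
                             | inr j => fun w => D (x j.+1) w - D (x j) w
                             end)).

Let tau := arrival_epoch E.

Let psi (s : R) : R := powR (s + theta) alpha - powR theta alpha.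

Let psi_ge0 s : 0 <= s -> 0 <= psi s.
Proof.
move=> s0; rewrite subr_ge0; apply: ge0_ler_powR; rewrite ?nnegrE.
- exact: ltW.
- exact: ltW.
- by rewrite addr_ge0// ltW.
- by rewrite lerDr.
Qed.

Let psi_gt0 s : 0 < s -> 0 < psi s.
Proof.
move=> s0; rewrite subr_gt0; apply: gt0_ltr_powR; rewrite ?nnegrE ?ltW//.
  by rewrite addr_gt0.
by rewrite ltrDr.
Qed.

Let mtau n : measurable_fun setT (tau n).
Proof. by apply: measurable_sum => i. Qed.

Let lv n (w : T) : R := left_value (fun x => D x w) (tau n w).

(** [D] at the rounded random time is a finite sum of an indicator of the grid value times [D] at a
    deterministic point; the left limit is the limit of these sums. *)
Let mlv n : measurable_fun setT (lv n).
Proof.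
pose f_ m w : R := \sum_(c < (m.+1 ^ 2).+1)
  \1_(grid_count m.+1 (m.+1 ^ 2) @^-1` [set (c : nat)]) (tau n w) *
    D (c%:R / m.+1%:R) w.
have f_E m w : f_ m w = D (grid_floor m (tau n w)) w.
  have cM : (grid_count m.+1 (m.+1 ^ 2) (tau n w) < (m.+1 ^ 2).+1)%N.
    by rewrite ltnS; exact: grid_count_le.
  rewrite /f_ (bigD1 (Ordinal cM))//= big1 ?addr0.
    by rewrite indicE mem_set//= mul1r.
  move=> c cne; rewrite indicE memNset ?mul0r//= => h.
  by move/eqP: cne; apply; apply/val_inj; rewrite /= h.
apply: (@measurable_fun_cvg _ _ _ setT f_).
  move=> m; apply: measurable_sum => c; apply: measurable_funM => //.
  apply: (measurableT_comp _ (mtau n)); apply: measurable_indic.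
  by rewrite -[X in measurable X]setTI; apply: measurable_grid_count.
move=> w _; under eq_fun do rewrite f_E.
have [t0|t0] := leP (tau n w) 0.
  rewrite /lv left_value_le0//; under eq_fun do rewrite grid_floor_le0// D0.
  exact: cvg_cst.
apply: (cvg_left_value (D := fun x => D x w)) => //.
- exact: D_mono.
- by move=> m; rewrite grid_floor_ge0 grid_floor_lt.
- exact/cvg_grid_floor/ltW.
Qed.

(** The paths to which [first_arrival_val] applies; integer times suffice by monotonicity. *)
Let unbounded n : set T := \bigcup_N [set w | lv n w < D N%:R w].

Let munbounded n : measurable (unbounded n).
Proof.
apply: bigcupT_measurable => N.
rewrite (_ : [set w | _] = (fun w => D N%:R w - lv n w) @^-1` `]0, +oo[).
  rewrite -[X in measurable X]setTI.
  by apply: (measurable_funB (mD _) (mlv n)).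
by apply/seteqP; split=> w /=; rewrite in_itv/= andbT subr_gt0.
Qed.

Let tc_arrivalE n w : tc_arrival D E n w = lv n w * \1_(unbounded n) w.
Proof.
have [h|h] := pselect (unbounded n w).
  rewrite indicE mem_set// mulr1.
  case: h => N _ /= h; apply: (first_arrival_val (D0 w) (@D_mono w)).
  by exists N%:R.
rewrite indicE memNset// mulr0.
apply: (first_arrival_none (D0 w) (@D_mono w)) => x x0.
rewrite leNgt; apply/negP => h'; apply: h; exists (Num.bound x) => //=.
apply: (lt_le_trans h'); apply: D_mono => //; apply: ltW; exact: archi_boundP.
Qed.

Lemma measurable_tc_interarrival n :
  measurable_fun setT (tc_interarrival D E n).
Proof.
have m k : measurable_fun setT (tc_arrival D E k).
  have -> : tc_arrival D E k = (fun w => lv k w * \1_(unbounded k) w).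
    by apply/funext => w; exact: tc_arrivalE.
  by apply: measurable_funM => //; exact: measurable_indic.
exact: measurable_funB.
Qed.

(** Positive [E n] keep the rounded epochs strictly below [tau n] for [n > 0]; unbounded paths make
    the indicator in [tc_arrivalE] equal to 1. *)
Let Omega : set T := (\bigcap_n [set w | 0 < E n w]) `&`
  \bigcap_(c : nat) \bigcup_N [set w | c%:R < D N%:R w].

Let mOmega : measurable Omega.
Proof.
apply: measurableI; apply: bigcapT_measurable => n.
  exact: measurable_gt_set.
by apply: bigcupT_measurable => N; exact: measurable_gt_set.
Qed.

(** Chernoff bound: on this set [1 <= exp(c) exp(- D N)] for every [N], and the expectation of
    [exp(- D N)] is [exp(- N psi(1))], which tends to 0. *)
Let null_bounded (c : nat) : P (~` \bigcup_N [set w | c%:R < D N%:R w]) = 0%E.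
Proof.
set A := ~` _.
have mA : measurable A.
  by apply: measurableC; apply: bigcupT_measurable => N; exact: measurable_gt_set.
have p0 := psi_gt0 ltr01.
have AN (N : nat) : fine (P A) <= expR c%:R * expR (- (N%:R * psi 1)).
  have -> : expR (- (N%:R * psi 1)) = \int[P]_w expR (- (1 * (D N%:R w - D 0 w))).
    by rewrite /Rintegral D_laplace//= subr0.
  have mex : measurable_fun setT (fun w => expR (- (1 * (D N%:R w - D 0 w)))).
    apply: measurableT_comp => //; apply: measurable_funN.
    by apply: measurable_funM => //; exact: measurable_funB.
  have iex : P.-integrable setT (EFin \o (fun w => expR (- (1 * (D N%:R w - D 0 w))))).
    apply: (@prob_integrable _ _ _ _ _ 1) => // w.
    rewrite ger0_norm ?expR_ge0// -[leRHS]expR0 ler_expR oppr_le0 mul1r subr_ge0.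
    exact: D_mono.
  rewrite -RintegralZl// -Rintegral_prob_indic//; apply: le_Rintegral => //.
  - apply: (@prob_integrable _ _ _ _ _ 1); first exact: measurable_indic.
    by move=> w; rewrite indicE; case: (_ \in _); rewrite ?normr1 ?normr0.
  - exact: integrableZlr.
  - move=> w _; rewrite indicE; case: (boolP (w \in A)) => [/set_mem wA|_]; last first.
      by rewrite mulr_ge0 ?expR_ge0.
    rewrite /= -expRD mul1r D0 subr0 -[leLHS]expR0 ler_expR subr_ge0 leNgt; apply/negP => h.
    by apply: wA; exists N.
have : fine (P A) <= 0.
  have c0 : (fun N : nat => expR c%:R * expR (- (N%:R * psi 1))) @ \oo -->
      expR c%:R * (0 : R).
    apply: cvgM; first exact: cvg_cst.
    under eq_fun do rewrite -mulrN expRM_natl.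
    by apply: cvg_expr; rewrite ger0_norm ?expR_ge0// -[ltRHS]expR0 ltr_expR oppr_lt0.
  rewrite mulr0 in c0; apply: (cvgr_to_ge c0); exact: nearW.
by rewrite prob_fin//; have /andP[a _] := fine_prob01 P mA => b; congr EFin; lra.
Qed.

Let null_Omega : P (~` Omega) = 0%E.
Proof.
have nE n : P (~` [set w | 0 < E n w]) = 0%E.
  rewrite probability_setC; last exact: measurable_gt_set.
  by rewrite Eexp// mulr0 oppr0 expR0 subee.
have mEn n : measurable (~` [set w | 0 < E n w]).
  by apply: measurableC; exact: measurable_gt_set.
have mbn (c : nat) : measurable (~` \bigcup_N [set w | c%:R < D N%:R w]).
  by apply: measurableC; apply: bigcupT_measurable => N; exact: measurable_gt_set.
apply/(negligibleP _ (measurableC mOmega)); rewrite setCI !setC_bigcap.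
apply: negligibleU; apply: negligible_bigcup => n.
  by apply/negligibleP; [exact: mEn|exact: nE].
by apply/negligibleP; [exact: mbn|exact: null_bounded].
Qed.

(** A sum of rounded times instead of a rounded sum: its n-th increment is a function of [E n]
    alone. *)
Let gtau (m n : nat) (w : T) : R := \sum_(i < n) grid_floor m (E i w).

Let gtau0 m w : gtau m 0 w = 0. Proof. by rewrite /gtau big_ord0. Qed.

Let gtauS m n w : gtau m n.+1 w = gtau m n w + grid_floor m (E n w).
Proof. by rewrite /gtau big_ord_recr. Qed.

Let gtau_ge0 m n w : 0 <= gtau m n w.
Proof. by apply: sumr_ge0 => i _; exact: grid_floor_ge0. Qed.

Let cvg_gtau n w : Omega w ->
  (fun m => D (gtau m n w) w) @ \oo --> tc_arrival D E n w.
Proof.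
move=> [hE hD]; have En i : 0 < E i w by exact: (hE i I).
have tcE : tc_arrival D E n w = lv n w.
  rewrite tc_arrivalE indicE mem_set ?mulr1//.
  have [N _ /= hN] := hD (Num.bound (lv n w)) I.
  exists N => //=; apply: lt_trans hN; apply: archi_boundP.
  exact: left_value_ge0 (D0 w) (@D_mono w) _.
(* For [n = 0] the epoch is 0 and [left_value] takes its default value 0, which agrees with
   [D 0]. *)
rewrite tcE; case: n {tcE} => [|n].
  under eq_fun do rewrite gtau0 D0.
  rewrite /lv left_value_le0; first exact: cvg_cst.
  by rewrite /tau /arrival_epoch big_ord0.
apply: (cvg_left_value (D := fun x => D x w)) => //.
- exact: D_mono.
- by rewrite /tau /arrival_epoch big_ord_recl ltr_wpDr// sumr_ge0// => i _; exact: ltW.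
- move=> m; rewrite gtau_ge0/= gtauS /tau /arrival_epoch big_ord_recr/=.
  by rewrite ler_ltD ?grid_floor_lt//; apply: ler_sum => i _; exact/grid_floor_le/ltW.
- rewrite /tau /arrival_epoch /gtau.
  elim: n.+1 => [|k IH].
    by under eq_fun do rewrite big_ord0; rewrite big_ord0; exact: cvg_cst.
  under eq_fun do rewrite big_ord_recr; rewrite big_ord_recr/=.
  by apply: cvgD => //; exact/cvg_grid_floor/ltW.
Qed.

Let phi (s : R) : R := lambda / (lambda + psi s).

(** [Eexp] makes [E n] positive only almost surely, whereas [laplace_survival] wants nonnegativity
    everywhere; hence the maximum with 0. *)
Let E_laplace n (a : R) : 0 <= a ->
  \int[P]_w expR (- (a * Num.max 0 (E n w))) = lambda / (lambda + a).
Proof.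
rewrite le_eqVlt => /predU1P[<-|a0].
  rewrite addr0 divff ?gt_eqF//.
  under eq_Rintegral do rewrite mul0r oppr0 expR0.
  exact: Rintegral_prob_cst.
have mM : measurable_fun setT (fun w => Num.max 0 (E n w)).
  by apply: measurable_maxr.
rewrite (laplace_survival P mM)//; last by move=> w; rewrite le_max lexx.
have la0 : 0 < lambda + a by rewrite addr_gt0.
have -> : \int[lebesgue_measure]_(t in `]0, +oo[)
    (expR (- (a * t)) * survival P (fun w => Num.max 0 (E n w)) t) =
    \int[lebesgue_measure]_(t in `]0, +oo[) (expR (- ((lambda + a) * t)) : R).
  apply: eq_Rintegral => t; rewrite inE/= in_itv/= andbT => t0.
  rewrite /survival (_ : [set w | _] = [set w | t < E n w]); last first.
    by apply/seteqP; split=> w /=; rewrite lt_max [t < 0]ltNge ltW.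
  by rewrite Eexp ?ltW//= -expRD; congr expR; ring.
rewrite (integrable_expRN la0).2.
by field; rewrite gt_eqF.
Qed.

(** * The joint transform over a random grid partition *)

Section grid_law.
Variables (m n : nat) (s : nat -> R).
Hypothesis s_ge0 : forall i, 0 <= s i.

Let K := (m.+1 ^ 2).+1.
Let cnt (e : R) : nat := grid_count m.+1 (m.+1 ^ 2) e.
Let cntK e : (cnt e < K)%N. Proof. by rewrite ltnS; exact: grid_count_le. Qed.
(** The default 0 past [n] makes the partition [xf f] eventually constant, hence monotone on all of
    [nat], as [indep] demands. *)
Let cf (f : {ffun 'I_n -> 'I_K}) (j : nat) : nat :=
  if insub j is Some i then f i else 0%N.
Let xf f (j : nat) : R := (\sum_(i < j) cf f i)%N%:R / m.+1%:R.
Let isc (c : nat) (e : R) : R := \1_(cnt @^-1` [set c]) e.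
(** Clipped at 0 so that it lies in [[0, 1]] on the whole line, as [indep_Rintegral] demands;
    increments of [D] are unaffected. *)
Let gD (a x : R) : R := expR (- (a * Num.max 0 x)).

Let cfE f (i : 'I_n) : cf f i = f i.
Proof. by rewrite /cf valK. Qed.

Let xfS f j : xf f j.+1 = xf f j + (cf f j)%:R / m.+1%:R.
Proof. by rewrite /xf big_ord_recr/= natrD mulrDl. Qed.

Let xf_ge0 f j : 0 <= xf f j. Proof. by rewrite divr_ge0. Qed.

Let xf_le f j : xf f j <= xf f j.+1. Proof. by rewrite xfS lerDl divr_ge0. Qed.

Let isc01 c e : 0 <= isc c e <= 1.
Proof. by rewrite /isc indicE; case: (_ \in _); rewrite ?lexx ?ler01. Qed.

Let misc c : measurable_fun setT (isc c).
Proof.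
apply: measurable_indic; rewrite -[X in measurable X]setTI.
exact: measurable_grid_count.
Qed.

Let iscE c e : isc c e = (c == cnt e)%:R.
Proof.
rewrite /isc indicE; congr (nat_of_bool _)%:R.
by apply/idP/eqP => [/set_mem/=->//|->]; rewrite mem_set.
Qed.

Let gD01 a x : 0 <= a -> 0 <= gD a x <= 1.
Proof.
move=> a0; rewrite expR_ge0/= -[leRHS]expR0 ler_expR oppr_le0 mulr_ge0//.
by rewrite le_max lexx.
Qed.

Let mgD a : measurable_fun setT (gD a).
Proof.
apply: measurableT_comp => //; apply: measurable_funN.
by apply: measurable_funM => //; exact: measurable_maxr.
Qed.

Let grid_prod (w : T) : R := \prod_(i < n)
  expR (- (s i * (D (gtau m i.+1 w) w - D (gtau m i w) w))).

Let term (f : {ffun 'I_n -> 'I_K}) (w : T) : R := \prod_(i < n) isc (f i) (E i w) *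
  \prod_(i < n) gD (s i) (D (xf f i.+1) w - D (xf f i) w).

(** Total probability: exactly one configuration [f] of grid counts occurs at [w], and for it the
    random partition coincides with the deterministic [xf f]. *)
Let grid_prodE w : grid_prod w = \sum_(f : {ffun 'I_n -> 'I_K}) term f w.
Proof.
pose f0 : {ffun 'I_n -> 'I_K} := [ffun i : 'I_n => Ordinal (cntK (E i w))].
rewrite (bigD1 f0)//= big1 ?addr0; last first.
  move=> f ff0; rewrite /term.
  have [i fi] : exists i, f i != f0 i.
    apply/existsP; rewrite -negb_forall; apply: contra ff0 => /forallP h.
    by apply/eqP/ffunP => i; apply/eqP.
  rewrite (bigD1 i)//= iscE (_ : (f i == _ :> nat) = false) ?mul0r//.
  by apply: contraNF fi; rewrite ffunE.
rewrite /term big1 ?mul1r; last by move=> i _; rewrite iscE ffunE eqxx.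
have xfE j : (j <= n)%N -> xf f0 j = gtau m j w.
  elim: j => [|j IH] jn; first by rewrite gtau0 /xf big_ord0 mul0r.
  rewrite xfS gtauS IH ?(ltnW jn)//; congr (_ + _ / _).
  by rewrite -[j]/(nat_of_ord (Ordinal jn)) cfE ffunE.
apply: eq_bigr => i _; rewrite /gD !xfE ?(ltnW (ltn_ord i))//.
rewrite max_r// subr_ge0; apply: D_mono => //.
by rewrite gtauS lerDl grid_floor_ge0.
Qed.

Let measurable_term f : measurable_fun setT (term f).
Proof.
apply: measurable_funM; apply: measurable_prod => i _.
  exact: measurableT_comp.
by apply: (measurableT_comp (mgD _)); exact: measurable_funB.
Qed.

Let term01 f w : 0 <= term f w <= 1.
Proof.
have a01 : 0 <= \prod_(i < n) isc (f i) (E i w) <= 1.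
  apply/andP; split; last by apply: prodr_ile1.
  by apply: prodr_ge0 => i _; case/andP: (isc01 (f i) (E i w)).
have b01 : 0 <= \prod_(i < n) gD (s i) (D (xf f i.+1) w - D (xf f i) w) <= 1.
  apply/andP; split; last by apply: prodr_ile1 => i _; exact: gD01.
  by apply: prodr_ge0 => i _; exact: expR_ge0.
by case/andP: a01 => a0 a1; case/andP: b01 => b0 b1; rewrite mulr_ge0// mulr_ile1.
Qed.

Let term_law f : \int[P]_w term f w = \prod_(i < n)
  (\int[P]_w isc (f i) (E i w) *
   expR (- (psi (s i) * ((f i)%:R / m.+1%:R)))).
Proof.
pose X (i : nat + nat) : T -> R := match i with
  | inl n => E n | inr j => fun w => D (xf f j.+1) w - D (xf f j) w end.
pose g (i : nat + nat) : R -> R := match i with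
  | inl j => isc (cf f j) | inr j => gD (s j) end.
pose J : seq (nat + nat) :=
  [seq inl j | j <- index_iota 0 n] ++ [seq inr j | j <- index_iota 0 n].
have uJ : uniq J.
  rewrite cat_uniq !map_inj_uniq ?iota_uniq ?andbT/=; try by move=> ? ? [].
  by apply/hasPn => _ /mapP[j _ ->]; apply/mapP => -[].
have mX i : measurable_fun setT (X i).
  by case: i => i //=; exact: measurable_funB.
have := @indep_Rintegral _ _ _ P _ X J g mX (indep (xf_ge0 f 0) (xf_le f)) uJ.
have mg i : measurable_fun setT (g i) by case: i => j; [exact: misc|exact: mgD].
have g01 i x : 0 <= g i x <= 1 by case: i => i; [exact: isc01|exact: gD01].
move=> /(_ mg g01).
rewrite big_cat !big_map/= !big_mkord => H.
transitivity (\int[P]_w (\prod_(i <- J) g i (X i w))).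
  apply: eq_Rintegral => w _; rewrite big_cat !big_map/= !big_mkord /term.
  by congr (_ * _); apply: eq_bigr => i _; rewrite cfE.
rewrite H big_split/=; congr (_ * _); apply: eq_bigr => i _.
  by rewrite cfE.
transitivity (\int[P]_w expR (- (s i * (D (xf f i.+1) w - D (xf f i) w)))).
  apply: eq_Rintegral => w _; rewrite /gD max_r// subr_ge0.
  by apply: D_mono => //; exact: xf_le.
have hD := @D_laplace (s i) (xf f i) (xf f i.+1) (s_ge0 i) (xf_ge0 f i) (xf_le f i).
by rewrite /Rintegral hD/=; congr (expR (- _)); rewrite xfS cfE /psi; ring.
Qed.

Lemma grid_law :
  measurable_fun setT grid_prod /\
  \int[P]_w grid_prod w =
  \prod_(i < n) \int[P]_w expR (- (psi (s i) * grid_floor m (E i w))).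
Proof.
have -> : grid_prod = (fun w => \sum_(f : {ffun 'I_n -> 'I_K}) term f w).
  by apply/funext => w; exact: grid_prodE.
split; first exact: measurable_sum.
have iterm f : P.-integrable setT (EFin \o term f).
  apply: (@prob_integrable _ _ _ _ _ 1) => // w.
  by have /andP[a b] := term01 f w; rewrite ger0_norm.
rewrite Rintegral_sum//.
under eq_bigr do rewrite term_law.
(* The law of each [term] is a product whose i-th factor sees only [f i], so the sum over
   configurations is a product of sums over grid values. *)
rewrite -(bigA_distr_bigA (fun (i : 'I_n) (c : 'I_K) =>
  \int[P]_w isc c (E i w) * expR (- (psi (s i) * (c%:R / m.+1%:R))))).
apply: eq_bigr => i _.
have iisc (c : nat) : P.-integrable setT (EFin \o (fun w => isc c (E i w))).
  apply: (@prob_integrable _ _ _ _ _ 1); first exact: measurableT_comp.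
  by move=> w; have /andP[a b] := isc01 c (E i w); rewrite ger0_norm.
transitivity (\int[P]_w (\sum_(c < K)
    expR (- (psi (s i) * (c%:R / m.+1%:R))) * isc c (E i w))).
  rewrite Rintegral_sum//; last by move=> c; exact: integrableZlr.
  by apply: eq_bigr => c _; rewrite RintegralZl// mulrC.
apply: eq_Rintegral => w _.
rewrite (bigD1 (Ordinal (cntK (E i w))))//= iscE eqxx mulr1 big1 ?addr0//.
move=> c cne; rewrite iscE (_ : (_ == _ :> nat) = false) ?mulr0//.
by apply: contraNF cne => /eqP e; apply/eqP/val_inj.
Qed.

End grid_law.

(** A version of the inter-arrival time that is nonnegative everywhere, being set to 0 off
    [Omega]. *)
Let X n (w : T) : R := tc_interarrival D E n w * \1_Omega w.

Let mX n : measurable_fun setT (X n).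
Proof.
by apply: measurable_funM; [exact: measurable_tc_interarrival|exact: measurable_indic].
Qed.

Let gtau_mono m n w : D (gtau m n w) w <= D (gtau m n.+1 w) w.
Proof. by apply: D_mono => //; rewrite gtauS lerDl grid_floor_ge0. Qed.

Let cvg_X n w : Omega w ->
  (fun m => D (gtau m n.+1 w) w - D (gtau m n w) w) @ \oo --> X n w.
Proof.
move=> Ow; rewrite /X indicE mem_set// mulr1.
by apply: cvgB; exact: cvg_gtau.
Qed.

Let X_ge0 n w : 0 <= X n w.
Proof.
have [Ow|Ow] := pselect (Omega w); last by rewrite /X indicE memNset// mulr0.
have c := @cvg_X n w Ow.
by apply: (cvgr_to_ge c); apply: nearW => m; rewrite subr_ge0 gtau_mono.
Qed.

Let expRX01 (a : R) n w : 0 <= a -> 0 <= expR (- (a * X n w)) <= 1.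
Proof.
by move=> a0; rewrite expR_ge0/= -[leRHS]expR0 ler_expR oppr_le0 mulr_ge0.
Qed.

Let mexpRX (a : R) n : measurable_fun setT (fun w => expR (- (a * X n w))).
Proof.
by apply: measurableT_comp => //; apply: measurable_funN; exact: measurable_funM.
Qed.

Let joint_laplace n (s : nat -> R) : (forall i, 0 <= s i) ->
  \int[P]_w (\prod_(i < n) expR (- (s i * X i w))) = \prod_(i < n) phi (s i).
Proof.
move=> s0.
have cL := @prob_cvg _ _ _ P (fun m w => \prod_(i < n)
    expR (- (s i * (D (gtau m i.+1 w) w - D (gtau m i w) w))))
  (fun w => \prod_(i < n) expR (- (s i * X i w))) Omega 1.
have {}cL := cL (fun m => (grid_law m n s0).1).
have cR : (fun m => \prod_(i < n)
      \int[P]_w expR (- (psi (s i) * grid_floor m (E i w)))) @ \oo -->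
    \prod_(i < n) phi (s i).
  apply: (@cvg_prod_ord _ n
    (fun i m => \int[P]_w expR (- (psi (s i) * grid_floor m (E i w))))
    (fun i => phi (s i))) => i.
  rewrite /phi -(E_laplace i (psi_ge0 (s0 i))).
  apply: (@prob_cvg _ _ _ _ _ _ setT 1) => //.
  - move=> m; apply: measurableT_comp => //; apply: measurable_funN.
    apply: measurable_funM => //; under eq_fun do rewrite grid_floorE.
    apply: measurable_sum => k; apply: measurable_funM => //.
    apply: measurableT_comp => //; apply: measurable_indic.
    rewrite (_ : [set _ | _] = ( *%R m.+1%:R) @^-1` `]k.+1%:R, +oo[); last first.
      by apply/seteqP; split=> x /=; rewrite in_itv/= andbT.
    by rewrite -[X in measurable X]setTI; apply: mulrl_measurable.
  - apply: measurableT_comp => //; apply: measurable_funN.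
    by apply: measurable_funM => //; exact: measurable_maxr.
  - by rewrite setCT measure0.
  - move=> w _; apply: cvg_expR.
    apply: cvgN; apply: cvgM; first exact: cvg_cst.
    (* [grid_floor] is 0 on nonpositive values, in agreement with the maximum with 0 in
       [E_laplace]. *)
    have [e0|e0] := leP (E i w) 0.
      by under eq_fun do rewrite grid_floor_le0//; exact: cvg_cst.
    exact/cvg_grid_floor/ltW.
  - move=> m w; rewrite ger0_norm ?expR_ge0// -[leRHS]expR0 ler_expR oppr_le0.
    by rewrite mulr_ge0 ?psi_ge0 ?grid_floor_ge0.
have E1 : (fun m => \int[P]_w (\prod_(i < n)
      expR (- (s i * (D (gtau m i.+1 w) w - D (gtau m i w) w))))) =
    (fun m => \prod_(i < n)
      \int[P]_w expR (- (psi (s i) * grid_floor m (E i w)))).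
  by apply/funext => m; exact: (grid_law m n s0).2.
rewrite E1 in cL; apply: (cvg_unique _ _ cR) => //; apply: cL => //.
- by apply: measurable_prod => i _.
- move=> w Ow; apply: (@cvg_prod_ord _ n
    (fun i m => expR (- (s i * (D (gtau m i.+1 w) w - D (gtau m i w) w))))
    (fun i => expR (- (s i * X i w)))) => i.
  apply: cvg_expR.
  by apply: cvgN; apply: cvgM; [exact: cvg_cst|exact: cvg_X].
- move=> m w; rewrite ger0_norm; last by apply: prodr_ge0 => i _; exact: expR_ge0.
  apply: prodr_ile1 => i _; rewrite expR_ge0/= -[leRHS]expR0 ler_expR oppr_le0.
  by rewrite mulr_ge0// subr_ge0.
Qed.

Let phi0 : phi 0 = 1.
Proof. by rewrite /phi /psi add0r subrr addr0 divff// gt_eqF. Qed.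

(** Indices outside [J] get the argument 0, where both the exponential and [phi] equal 1. *)
Let joint_list (J : seq nat) (k : nat -> nat) : uniq J ->
  \int[P]_w (\prod_(i <- J) expR (- ((k i)%:R * X i w))) =
  \prod_(i <- J) phi (k i)%:R.
Proof.
move=> uJ; pose n := (\max_(i <- J) i).+1.
have Jn i : i \in J -> (i < n)%N by move=> iJ; rewrite ltnS; exact: leq_bigmax_seq.
pose s i : R := if i \in J then (k i)%:R else 0.
have s0 i : 0 <= s i by rewrite /s; case: ifP.
transitivity (\int[P]_w (\prod_(i < n) expR (- (s i * X i w)))).
  apply: eq_Rintegral => w _; rewrite -(prod_ord_mem _ uJ Jn).
  apply: eq_bigr => i _; rewrite /s; case: ifP => // _.
  by rewrite mul0r oppr0 expR0.
rewrite joint_laplace// -(prod_ord_mem _ uJ Jn); apply: eq_bigr => i _.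
by rewrite /s; case: ifP.
Qed.

Let ray (t : R) : set R := [set y | y < t].

Let mray t : measurable (ray t).
Proof. by rewrite (_ : ray t = `]-oo, t[%classic). Qed.

Let mXpre n (C : set R) : measurable C -> measurable (X n @^-1` C).
Proof. by move=> mC; rewrite -[X in measurable X]setTI; exact: mX. Qed.

(** Each exponential factor is traded for a ray by [laplace_unique], with the other factors as
    weight on one side and a constant on the other. Comparing with [X 0] throughout yields
    independence and equality of laws together. *)
Let joint_ray (J2 J1 : seq nat) (k : nat -> nat) (t : nat -> R) :
  uniq (J1 ++ J2) ->
  \int[P]_w (\prod_(i <- J1) expR (- ((k i)%:R * X i w)) *
             \prod_(i <- J2) \1_(ray (t i)) (X i w)) =
  \prod_(i <- J1) phi (k i)%:R *
  \prod_(i <- J2) fine (P (X 0 @^-1` ray (t i))).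
Proof.
elim: J2 J1 k => [|i J2 IH] J1 k.
  rewrite cats0 big_nil mulr1 => uJ; rewrite -joint_list//.
  by apply: eq_Rintegral => w _; rewrite big_nil mulr1.
rewrite -cat1s uniq_catCA/= => /andP[iJ u12].
have iJ1 : i \notin J1 by apply: contra iJ; rewrite mem_cat => ->.
pose Z w : R := \prod_(j <- J1) expR (- ((k j)%:R * X j w)) *
                \prod_(j <- J2) \1_(ray (t j)) (X j w).
pose C : R := \prod_(j <- J1) phi (k j)%:R *
              \prod_(j <- J2) fine (P (X 0 @^-1` ray (t j))).
have mZ : measurable_fun setT Z.
  apply: measurable_funM; apply: measurable_prod => j _; first exact: mexpRX.
  by apply: measurableT_comp => //; exact: measurable_indic.
have Z1 w : `|Z w| <= 1.
  rewrite ger0_norm; last first.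
    by rewrite mulr_ge0//; apply: prodr_ge0 => j _; rewrite ?expR_ge0.
  rewrite mulr_ile1//; try by apply: prodr_ge0 => j _; rewrite ?expR_ge0.
    by apply: prodr_ile1 => j _; exact: expRX01.
  apply: prodr_ile1 => j _; rewrite indicE.
  by case: (_ \in _); rewrite ?lexx ?ler01.
have iZ : P.-integrable setT (EFin \o Z) by exact: prob_integrable Z1.
have iC : P.-integrable setT (EFin \o (fun _ : T => C)).
  by apply: (@prob_integrable _ _ _ _ _ `|C|).
have L := @laplace_unique R _ _ _ _ P P setT setT Z (X i) (fun=> C) (X 0)
  measurableT iZ (mX i) (fun w _ => X_ge0 i w)
  measurableT iC (mX 0) (fun w _ => X_ge0 0 w).
transitivity (\int[P]_w (Z w * \1_(ray (t i)) (X i w))).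
  by apply: eq_Rintegral => w _; rewrite big_cons /Z; ring.
rewrite L; last first.
  (* The induction hypothesis at [i :: J1], with the free argument [n] at [i], is the transform
     identity to be checked. *)
  move=> n; pose k' j := if j == i then n else k j.
  have k'E (h : nat -> nat -> R) :
      \prod_(j <- J1) h j (k' j) = \prod_(j <- J1) h j (k j).
    apply: eq_big_seq => j jJ; rewrite /k'; case: eqP => // ji.
    by rewrite -ji jJ in iJ1.
  transitivity (\int[P]_w (\prod_(j <- i :: J1) expR (- ((k' j)%:R * X j w)) *
      \prod_(j <- J2) \1_(ray (t j)) (X j w))).
    apply: eq_Rintegral => w _.
    rewrite big_cons (k'E (fun j n => expR (- (n%:R * X j w)))) {1}/k' eqxx /Z.
    ring.
  rewrite IH/= ?iJ// big_cons (k'E (fun j n => phi n%:R)) {1}/k' eqxx -mulrA -/C.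
  have := joint_list (J := [:: 0%N]) (fun=> n) isT; rewrite big_seq1 => <-.
  rewrite mulrC -RintegralZl//; last first.
    apply: (@prob_integrable _ _ _ _ _ 1).
      by apply: measurable_prod => j _; exact: mexpRX.
    by move=> w; rewrite big_seq1 ger0_norm ?expR_ge0//;
       have /andP[] := expRX01 0 w (ler0n R n).
  by apply: eq_Rintegral => w _; rewrite big_seq1.
rewrite RintegralZl//; last first.
  apply: (@prob_integrable _ _ _ _ _ 1).
    by apply: measurableT_comp => //; apply: measurable_indic; exact: mray.
  by move=> w; rewrite indicE; case: (_ \in _); rewrite ?normr1 ?normr0.
rewrite (_ : \int[P]_w \1_(ray (t i)) (X 0 w) =
    fine (P (X 0 @^-1` ray (t i)))); last first.
  rewrite -Rintegral_prob_indic; last by apply: mXpre; exact: mray.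
  by apply: eq_Rintegral => w _; rewrite !indicE.
by rewrite big_cons /C; ring.
Qed.

(** Same exchange as in [joint_ray], now from rays to Borel sets by [ray_indep_ext]. *)
Let joint_borel (J1 J2 : seq nat) (B : nat -> set R) (t : nat -> R) :
  uniq (J1 ++ J2) -> (forall i, measurable (B i)) ->
  P (\big[setI/setT]_(i <- J1) (X i @^-1` B i) `&`
     \big[setI/setT]_(i <- J2) (X i @^-1` ray (t i))) =
  (\prod_(i <- J1) fine (P (X 0 @^-1` B i)) *
   \prod_(i <- J2) fine (P (X 0 @^-1` ray (t i))))%:E.
Proof.
move=> + mB; have mI2 (J : seq nat) (C : nat -> set R) :
    (forall i, measurable (C i)) ->
    measurable (\big[setI/setT]_(i <- J) (X i @^-1` C i)).
  by move=> mC; apply: bigsetI_measurable => i _; exact: mXpre.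
elim: J1 J2 t => [|i J1 IH] J2 t.
  move=> u2; rewrite !big_nil setTI mul1r.
  have := @joint_ray J2 [::] (fun=> 0%N) t u2.
  rewrite big_nil mul1r => <-.
  transitivity ((fine (P (\big[setI/setT]_(i <- J2) (X i @^-1` ray (t i)))))%:E).
    by rewrite -prob_fin//; exact: mI2.
  rewrite -Rintegral_prob_indic; last exact: mI2.
  congr EFin; apply: eq_Rintegral => w _.
  by rewrite big_nil mul1r (prod_indic X J2 (fun i => ray (t i))).
rewrite cat_cons cons_uniq => /andP[iJ u12].
have iJ2 : i \notin J2 by apply: contra iJ; rewrite mem_cat orbC => ->.
set A := \big[setI/setT]_(j <- J1) (X j @^-1` B j) `&`
         \big[setI/setT]_(j <- J2) (X j @^-1` ray (t j)).
set c := \prod_(j <- J1) fine (P (X 0 @^-1` B j)) *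
         \prod_(j <- J2) fine (P (X 0 @^-1` ray (t j))).
have mA : measurable A by apply: measurableI; exact: mI2.
have c0 : 0 <= c.
  by rewrite mulr_ge0//; apply: prodr_ge0 => j _; rewrite fine_ge0.
rewrite [X in P X](_ : _ = A `&` X i @^-1` B i); last first.
  by rewrite big_cons -setIA setIC.
rewrite (ray_indep_ext mA c0 (mX i) (mX 0)).
- by rewrite big_cons /c; congr EFin; ring.
- move=> x; pose t' j := if j == i then x else t j.
  have t'E j : j \in J2 -> t' j = t j.
    by move=> jJ; rewrite /t'; case: eqP => // ji; rewrite -ji jJ in iJ2.
  have := IH (i :: J2) t'.
  rewrite -cat1s uniq_catCA/= iJ u12 => /(_ isT); rewrite !big_cons {1 3}/t' eqxx.
  have -> : \big[setI/setT]_(j <- J2) (X j @^-1` ray (t' j)) =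
      \big[setI/setT]_(j <- J2) (X j @^-1` ray (t j)).
    by apply: eq_big_seq => j jJ; rewrite t'E.
  have -> : \prod_(j <- J2) fine (P (X 0 @^-1` ray (t' j))) =
      \prod_(j <- J2) fine (P (X 0 @^-1` ray (t j))).
    by apply: eq_big_seq => j jJ; rewrite t'E.
  rewrite (setIC (X i @^-1` _)) setIA => ->.
  by rewrite /c; congr EFin; ring.
- exact: mB.
Qed.

Let prob_eq_Omega (A B : set T) : measurable A -> measurable B ->
  A `&` Omega = B `&` Omega -> P A = P B.
Proof.
move=> mA mB AB.
have H C : measurable C -> P C = P (C `&` Omega).
  move=> mC; transitivity (P (C `\` Omega) + P (C `&` Omega))%E.
    exact: measureDI.
  rewrite (_ : P (C `\` Omega) = 0%E) ?add0e//.
  apply/eqP; rewrite eq_le measure_ge0 andbT -null_Omega le_measure ?inE//.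
  - exact: measurableD.
  - exact: measurableC.
by rewrite H// [RHS]H// AB.
Qed.

Let joint_W (J : seq nat) (B : nat -> set R) : uniq J ->
  (forall i, measurable (B i)) ->
  P (\big[setI/setT]_(i <- J) (tc_interarrival D E i @^-1` B i)) =
  (\prod_(i <- J) fine (P (X 0 @^-1` B i)))%:E.
Proof.
move=> uJ mB; have := @joint_borel J [::] B (fun=> 0).
rewrite cats0 !big_nil setIT mulr1 => <- //.
apply: prob_eq_Omega.
- apply: bigsetI_measurable => i _; rewrite -[X in measurable X]setTI.
  exact: measurable_tc_interarrival.
- by apply: bigsetI_measurable => i _; exact: mXpre.
elim: J {uJ} => [|i J IH]; first by rewrite !big_nil.
rewrite !big_cons setIIl IH [RHS]setIIl; congr (_ `&` _).
by apply/seteqP; split=> w [+ Ow]; rewrite /X /= indicE mem_set// mulr1.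
Qed.

Let W_law n (B : set R) : measurable B ->
  P (tc_interarrival D E n @^-1` B) = (fine (P (X 0 @^-1` B)))%:E.
Proof.
move=> mB; have := @joint_W [:: n] (fun=> B) isT (fun=> mB).
by rewrite !big_seq1.
Qed.

Lemma tc_interarrival_indep : mutually_independent P (tc_interarrival D E).
Proof.
by move=> J B uJ mB; rewrite joint_W//; congr EFin; apply: eq_bigr => i _; rewrite W_law.
Qed.

Lemma tc_interarrival_identical n (B : set R) : measurable B ->
  P (tc_interarrival D E n @^-1` B) = P (tc_interarrival D E 0 @^-1` B).
Proof. by move=> mB; rewrite !W_law. Qed.

Lemma tc_interarrival_laplace : exists2 H : R -> R,
  [/\ measurable_fun setT H, forall t, 0 <= H t <= 1,
      forall t, H x @[x --> t^'+] --> H t &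
      forall s, 0 < s -> \int[lebesgue_measure]_(t in `]0, +oo[)
        (expR (- (s * t)) * H t) = s^-1 * (psi s / (psi s + lambda))] &
  forall n t, P [set w | t < tc_interarrival D E n w] = (H t)%:E.
Proof.
exists (survival P (X 0)); last first.
  move=> n t; rewrite [X in P X](_ : _ = tc_interarrival D E n @^-1` `]t, +oo[).
    rewrite W_law// /survival; congr (fine (P _))%:E.
    by apply/seteqP; split=> w /=; rewrite in_itv/= andbT.
  by apply/seteqP; split=> w /=; rewrite in_itv/= andbT.
split.
- exact: measurable_survival.
- exact: survival01.
- exact: survival_right_continuous.
- move=> s s0; have := laplace_survival P (mX 0) (X_ge0 0) s0.
  have := @joint_laplace 1 (fun=> s) (fun=> ltW s0).
  rewrite big_ord1 (_ : \int[P]_w _ = \int[P]_w expR (- (s * X 0 w))); last first.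
    by apply: eq_Rintegral => w _; rewrite big_ord1.
  move=> ->; set I := \int[lebesgue_measure]_(t in _) _ => e.
  have p0 := psi_gt0 s0; have l0 := lambda_gt0.
  apply: (mulfI (lt0r_neq0 s0)); rewrite mulVKf ?gt_eqF//.
  (* The one-coordinate case of [joint_laplace] meets the Tonelli formula [phi s = 1 - s I]. *)
  have -> : s * I = 1 - phi s by rewrite e; ring.
  by rewrite /phi; field; rewrite gt_eqF//; lra.
Qed.

End tempered_arrivals.

(** * The survival function of the inter-arrival times *)

Section survival_function.
Variable R : realType.
Notation mu := (@lebesgue_measure R).
Notation Rpos := (`]0, +oo[%classic : set R).

Lemma powR_unbounded (alpha c : R) : 0 < alpha -> exists2 z : R,
  0 < z & c < powR z alpha.
Proof.
move=> a0; pose y := Num.max c 0 + 1; have y0 : 0 < y.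
  by rewrite ltr_wpDl// le_max lexx orbT.
exists (powR y alpha^-1); first exact: powR_gt0.
rewrite -powRrM mulVf ?gt_eqF// powRr1 ?ltW//.
by rewrite /y ltr_pwDr// le_max lexx.
Qed.

Lemma survival_series (lambda theta alpha : R) (H : R -> R) :
  0 < lambda -> 0 < theta -> 0 < alpha ->
  measurable_fun setT H -> (forall t, 0 <= H t <= 1) ->
  (forall t, H x @[x --> t^'+] --> H t) ->
  (forall s, 0 < s -> \int[mu]_(t in Rpos) (expR (- (s * t)) * H t) =
     s^-1 * ((powR (s + theta) alpha - powR theta alpha) /
             (powR (s + theta) alpha - powR theta alpha + lambda))) ->
  forall t : R, 0 <= t ->
  let inner q := fun r : nat =>
    (- (lambda * powR t alpha)) ^+ r *
      ML3 alpha (r%:R * alpha + q%:R + 1) r%:R (powR theta alpha * powR t alpha) in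
  let outer := fun q : nat => (theta * t) ^+ q * limn (series (inner q)) in
  (forall q, cvgn (series (inner q))) /\ cvgn (series outer) /\
  H t = expR (- (theta * t)) * limn (series outer).
Proof.
move=> l0 th0 a0 mH H01 Hr HL.
have [z1 z10 hz1] := powR_unbounded (powR theta alpha + lambda) a0.
pose z0 := Num.max z1 (theta + 1).
have tz0 : theta < z0 by rewrite lt_max ltrDl ltr01 orbT.
have z0_large : powR theta alpha + lambda < powR z0 alpha.
  apply: (lt_le_trans hz1); apply: ge0_ler_powR.
  - exact: ltW.
  - by rewrite nnegrE ltW.
  - by rewrite nnegrE ltW// (lt_trans th0).
  - by rewrite le_max lexx.
have [cin [cout [mo ob orc oL]]] :=
  laplace_at_mittag_leffler l0 th0 a0 tz0 z0_large.
move: cin cout mo ob orc oL; set out := (fun t => limn (series _)).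
set K := _ * _ => cin cout mo ob orc oL.
(* Then [s0 + theta = z0 + 1], so all [z = s0 + theta + n] lie where the series transform is known.
   The factor [exp(- s0 t)] also makes the bounded [H] integrable, and it is cancelled at the
   end. *)
pose s0 := z0 - theta + 1; have s00 : 0 < s0 by rewrite /s0; lra.
have zs n : z0 < s0 + theta + n%:R.
  by have := ler0n R n; rewrite /s0; lra.
have mD : measurable (Rpos : set (measurableTypeR R)) by exact: measurable_itv.
pose f t := expR (- (s0 * t)) * H t.
pose g t := expR (- ((s0 + theta) * t)) * out t.
have if_ : mu.-integrable Rpos (EFin \o f).
  apply: (integrable_bounded_mul (M := 1) mD (integrable_expRN s00).1).
    exact: measurable_funTS.
  by move=> t _; have /andP[h0 h1] := H01 t; rewrite ger0_norm.
have ig : mu.-integrable Rpos (EFin \o g).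
  by apply: (laplace_integrable _ mo ob); have := zs 0%N; rewrite addr0.
have cexp (a t : R) : expR (- (a * x)) @[x --> t^'+] --> expR (- (a * t)).
  apply: cvg_at_right_filter; apply: (@continuous_comp _ _ _ (fun x => - (a * x)) expR).
    by apply: continuousN; exact: mulrl_continuous.
  exact: continuous_expR.
have fg : forall t, 0 <= t -> f t = g t.
  apply: (right_cont_eq if_ ig).
  - by move=> t t0; apply: cvgM; [exact: cexp|exact: Hr].
  - by move=> t t0; apply: cvgM; [exact: cexp|exact: orc].
  apply: (@laplace_unique R _ _ _ _ mu mu Rpos Rpos f id g id) => //.
  - by move=> x; rewrite /= in_itv/= andbT => /ltW.
  - by move=> x; rewrite /= in_itv/= andbT => /ltW.
  - move=> n; have sn0 : 0 < s0 + n%:R by rewrite ltr_pwDl.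
    transitivity (\int[mu]_(t in Rpos) (expR (- ((s0 + n%:R) * t)) * H t)).
      apply: eq_Rintegral => t _; rewrite /f mulrAC -expRD.
      by congr (expR _ * _); ring.
    transitivity (\int[mu]_(t in Rpos) (expR (- ((s0 + theta + n%:R) * t)) * out t)); last first.
      apply: eq_Rintegral => t _; rewrite /g mulrAC -expRD.
      by congr (expR _ * _); ring.
    rewrite HL// oL//; congr (_^-1 * (_ / _)); first ring.
      by congr (powR _ _ - _); ring.
    by congr (powR _ _ - _ + _); ring.
move=> t t0 inner outer; split; first by move=> q; exact: cin.
split; first exact: cout.
have := fg t t0; rewrite /f /g => e.
apply: (mulfI (lt0r_neq0 (expR_gt0 (- (s0 * t))))).
by rewrite e mulrA -expRD; congr (expR _ * _); ring.
Qed.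

End survival_function.

Theorem theorem4p3 (R : realType) (d : measure_display) (T : measurableType d)
  (P : probability T R)
  (k : nat) (lambda mu theta alpha : R)
  (hk : (1 <= k)%N) (hlambda : 0 < lambda) (hmu : 0 < mu) (htheta : 0 < theta)
  (halpha0 : 0 < alpha) (halpha1 : alpha < 1)
  (* inter-arrival times of the underlying Poisson(lambda) arrival stream *)
  (E : nat -> T -> R)
  (hEmeas : forall n, measurable_fun setT (E n))
  (hEexp : forall n (x : R), 0 <= x ->
             P [set w | x < E n w] = (expR (- (lambda * x)))%:E)
  (* the tempered stable subordinator D_{theta,alpha} *)
  (D : R -> T -> R)
  (hDmeas : forall x, measurable_fun setT (D x))
  (hD0 : forall w, D 0 w = 0)
  (hDmono : forall w (x y : R), 0 <= x -> x <= y -> D x w <= D y w)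
  (hDrc : forall w (x : R), 0 <= x -> (fun z => D z w) @ x^'+ --> D x w)
  (hDlaplace : forall (s x y : R), 0 <= s -> 0 <= x -> x <= y ->
     (\int[P]_w (expR (- (s * (D y w - D x w))))%:E)%E =
       (expR (- ((y - x) * (powR (s + theta) alpha - powR theta alpha))))%:E)
  (* E_0, E_1, ... and the increments of D over any partition are mutually
     independent (iid arrivals, independent increments, D independent of Q) *)
  (hindep : forall x : nat -> R, 0 <= x 0%N -> (forall j, x j <= x j.+1) ->
     mutually_independent P
       (fun i : nat + nat => match i with
                             | inl n => E n
                             | inr j => fun w => D (x j.+1) w - D (x j) w
                             end)) :
  let W := tc_interarrival D E in
  (forall n, measurable_fun setT (W n)) /\
  mutually_independent P W /\
  (forall n (B : set R), measurable B -> P (W n @^-1` B) = P (W 0%N @^-1` B)) /\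
  (forall t : R, 0 <= t ->
    let inner q := fun r : nat =>
      (- (lambda * powR t alpha)) ^+ r *
        ML3 alpha (r%:R * alpha + q%:R + 1) r%:R (powR theta alpha * powR t alpha) in
    let outer := fun q : nat => (theta * t) ^+ q * limn (series (inner q)) in
    (forall q, cvgn (series (inner q))) /\
    cvgn (series outer) /\
    (forall n, P [set w | t < W n w] =
                 (expR (- (theta * t)) * limn (series outer))%:E)).
Proof.
have mW := measurable_tc_interarrival hEmeas hDmeas hD0 hDmono.
split; first exact: mW.
split.
  exact: (tc_interarrival_indep hlambda htheta halpha0 hEmeas hEexp hDmeas hD0
    hDmono hDlaplace hindep).
split=> [n B mB|t t0].
  exact: (tc_interarrival_identical hlambda htheta halpha0 hEmeas hEexp hDmeas
    hD0 hDmono hDlaplace hindep).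
have [H [mH H01 Hr HL] PH] := tc_interarrival_laplace hlambda htheta halpha0
  hEmeas hEexp hDmeas hD0 hDmono hDlaplace hindep.
have [cin [cout Ht]] :=
  survival_series hlambda htheta halpha0 mH H01 Hr HL t0.
by move=> inner outer; split=> //; split=> // n; rewrite PH Ht.
Qed.
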